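(* Let $E$ be an MLTS expression all of whose match clauses satisfy the restrictions stated in the context. If $\vdash E\Downarrow V$ and $\vdash E\Downarrow U$ are both derivable, then $V = U$ (equality modulo $\alpha\beta\eta$-conversion).
   Context: MLTS abstract syntax: simply typed meta-level $\lambda$-terms modulo $\alpha\beta\eta$, with expression formers $\mathrm{lam}\,R$, $\mathrm{app}\,M\,N$, $\mathrm{let}\,M\,R$, $\mathrm{fix}\,R$, $\mathrm{variant}\,c\,[T_1,\dots,T_n]$, $\mathrm{new}(\lambda X.E)$, $\mathrm{backslash}(\lambda X.E)$ (written $X\backslash E$), $\mathrm{arobase}\,M\,X$ (written $M\,@\,X$), and $\mathrm{match}\,T\,[R_1,\dots,R_n]$; clauses are built from $\mathrm{all}(\lambda x.R)$ (pattern variable), $\mathrm{nab}(\lambda Z.R)$ (clause-local nominal) and $p\Longrightarrow u$; patterns from $\mathrm{pvariant}\,c\,[p_1..p_n]$, $\mathrm{pnom}\,c$, $\mathrm{pvar}\,x$, and pattern versions of backslash and $@$. Nominals are fresh constants introduced by the generic quantifier $\nabla$ ($\nabla X.\varphi$ holds iff $\varphi[c/X]$ for a fresh nominal $c$). Nominal abstraction: $s\unrhd t$ holds iff $s$ is $\lambda$-convertible to $\lambda c_1\ldots\lambda c_n.t$ (the term obtained by replacing distinct nominals $c_i$ of $t$ by fresh bound variables) for some distinct nominals $c_1,\dots,c_n$. Evaluation $\vdash E\Downarrow V$ (read as formulas of the logic $\mathcal{G}$) is the least relation closed under: $\mathrm{lam}\,R\Downarrow\mathrm{lam}\,R$; $\mathrm{variant}\,c\,[T_i]\Downarrow\mathrm{variant}\,c\,[V_i]$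 if each $T_i\Downarrow V_i$; $\mathrm{new}(\lambda X.E\,X)\Downarrow V$ if $\nabla X.(E\,X\Downarrow V)$; $\mathrm{app}\,M\,N\Downarrow V$ if $M\Downarrow\mathrm{lam}\,R$, $N\Downarrow U$, $R\,U\Downarrow V$; $\mathrm{let}\,M\,R\Downarrow V$ if $M\Downarrow U$, $R\,U\Downarrow V$; $\mathrm{fix}\,R\Downarrow V$ if $R(\mathrm{fix}\,R)\Downarrow V$; $\mathrm{arobase}\,M\,X\Downarrow V$ if $M\Downarrow\mathrm{backslash}\,R$ and $R\,X\Downarrow V$; $\mathrm{backslash}(\lambda X.E\,X)\Downarrow\mathrm{backslash}(\lambda X.V\,X)$ if $\nabla X.(E\,X\Downarrow V\,X)$; $\mathrm{match}\,T\,(Rule::Rules)\Downarrow V$ if $\mathrm{clause}(T,Rule,U)$ and $U\Downarrow V$; $\mathrm{match}\,T\,(Rule::Rules)\Downarrow V$ if $\neg\exists u.\,\mathrm{clause}(T,Rule,u)$ and $\mathrm{match}\,T\,Rules\Downarrow V$. Clause relation: $\mathrm{clause}(T,\mathrm{all}(\lambda x.P\,x),U)$ if $\exists x.\,\mathrm{clause}(T,P\,x,U)$; $\mathrm{clause}(T,\mathrm{nab}\,Z_1\ldots\mathrm{nab}\,Z_m.(p\Longrightarrow u),U)$ if $T$ matches $P$ and $(\lambda Z_1\ldots\lambda Z_m.(p\Longrightarrow u))\unrhd(P\Longrightarrow U)$. Match relation: $\mathrm{variant}\,c\,[t_i]$ matches $\mathrm{pvariant}\,c\,[p_i]$ if each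 $t_i$ matches $p_i$; a nominal $c$ matches $\mathrm{pnom}\,c$; any term $x$ matches $\mathrm{pvar}\,x$. Restrictions on match clauses: (1) each pattern variable occurs exactly once in its pattern; (2) every pattern subexpression of the form $r\,@\,X_1\ldots X_n$ has $r$ a pattern variable and $X_1,\dots,X_n$ ($n\ge 0$) distinct nominals whose binders lie within the scope of the (outermost, implicit) binding of $r$ (higher-order pattern restriction); (3) every \texttt{nab}-bound nominal has at least one rigid occurrence in the pattern within the scope of its binder, where an occurrence is flexible if it lies in the scope of an $@$ and rigid otherwise. *)

(* Defs.v *)
(* MLTS abstract syntax in canonical (beta-normal, eta-long)
   form with de Bruijn indices for meta-level bound variables and natural-number
   atoms for nominal constants. *)
From Stdlib Require Import List Arith Bool.
Import ListNotations.

(* Syntax.  Every binder ( lam R, let M R, fix R, new, backslash, all,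
   nab, pattern backslash ) binds exactly one meta-level variable of the
   expression type; the bound variable is de Bruijn index 0 of the body.  *)
Inductive expr : Type :=
| EBVar : nat -> expr
| ENom : nat -> expr
| ELam : expr -> expr
| EApp : expr -> expr -> expr
| ELet : expr -> expr -> expr
| EFix : expr -> expr
| EVariant : nat -> list expr -> expr
| ENew : expr -> expr
| EBack : expr -> expr
| EArob : expr -> expr -> expr
| EMatch : expr -> list rule -> expr
with rule : Type :=
| RAll : rule -> rule
| RNab : rule -> rule
| RArrow : pat -> expr -> rule
with pat : Type :=
| PVariant : nat -> list pat -> pat
| PNom : expr -> pat
| PVar : expr -> pat
| PBack : pat -> pat
| PArob : pat -> expr -> pat.

(* Generic traversal: [fv c i] rewrites a variable of index i found under
   c local binders, [fn c a] rewrites the nominal a found under c binders. *)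
Section Trav.
Variable fv : nat -> nat -> expr.
Variable fn : nat -> nat -> expr.

Fixpoint tr_e (c : nat) (e : expr) : expr :=
  match e with
  | EBVar i => fv c i
  | ENom a => fn c a
  | ELam b => ELam (tr_e (S c) b)
  | EApp m n => EApp (tr_e c m) (tr_e c n)
  | ELet m b => ELet (tr_e c m) (tr_e (S c) b)
  | EFix b => EFix (tr_e (S c) b)
  | EVariant k ts => EVariant k (map (tr_e c) ts)
  | ENew b => ENew (tr_e (S c) b)
  | EBack b => EBack (tr_e (S c) b)
  | EArob m x => EArob (tr_e c m) (tr_e c x)
  | EMatch t rs => EMatch (tr_e c t) (map (tr_r c) rs)
  end
with tr_r (c : nat) (r : rule) : rule :=
  match r with
  | RAll b => RAll (tr_r (S c) b)
  | RNab b => RNab (tr_r (S c) b)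
  | RArrow p u => RArrow (tr_p c p) (tr_e c u)
  end
with tr_p (c : nat) (p : pat) : pat :=
  match p with
  | PVariant k ps => PVariant k (map (tr_p c) ps)
  | PNom e => PNom (tr_e c e)
  | PVar e => PVar (tr_e c e)
  | PBack q => PBack (tr_p (S c) q)
  | PArob q e => PArob (tr_p c q) (tr_e c e)
  end.
End Trav.

Definition lift_fv (d : nat) (c i : nat) : expr :=
  if i <? c then EBVar i else EBVar (i + d).
Definition keep_nom (c a : nat) : expr := ENom a.
Definition lift_e (d : nat) (e : expr) : expr := tr_e (lift_fv d) keep_nom 0 e.

(* meta-level beta-reduction (R U): substitute s for the variable bound by
   the abstraction whose body is given *)
Definition open_fv (s : expr) (c i : nat) : expr :=
  if i <? c then EBVar i
  else if i =? c then lift_e c s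
  else EBVar (pred i).
Definition open_e (b s : expr) : expr := tr_e (open_fv s) keep_nom 0 b.
Definition open_r (b : rule) (s : expr) : rule := tr_r (open_fv s) keep_nom 0 b.
Definition open_p (b : pat) (s : expr) : pat := tr_p (open_fv s) keep_nom 0 b.

Fixpoint index_of (a : nat) (cs : list nat) : option nat :=
  match cs with
  | [] => None
  | c :: cs' => if a =? c then Some 0
                else option_map S (index_of a cs')
  end.

(* [close_r cs t] is the body of  \c1 ... \cn . t  (n = length cs), i.e. t
   with the nominals c1..cn replaced by fresh bound variables (c1 outermost). *)
Definition close_fv (n c i : nat) : expr :=
  if i <? c then EBVar i else EBVar (i + n).
Definition close_fn (cs : list nat) (c a : nat) : expr :=
  match index_of a cs with
  | Some j => EBVar (c + (length cs - 1 - j))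
  | None => ENom a
  end.
Definition close_r (cs : list nat) (t : rule) : rule :=
  tr_r (close_fv (length cs)) (close_fn cs) 0 t.

(* Nominal abstraction  s |> t  for s of type tm -> ... -> tm -> rule
   (m arrows), s being represented by its body [sb] under m binders:
   s is convertible to \c1..\cn. t for some distinct nominals c1..cn. *)
Definition nom_abs (m : nat) (sb : rule) (t : rule) : Prop :=
  exists cs : list nat, length cs = m /\ NoDup cs /\ sb = close_r cs t.

Fixpoint occ_e (a : nat) (e : expr) : bool :=
  match e with
  | EBVar _ => false
  | ENom b => a =? b
  | ELam b | EFix b | ENew b | EBack b => occ_e a b
  | EApp m n | ELet m n | EArob m n => occ_e a m || occ_e a n
  | EVariant _ ts => existsb (occ_e a) ts
  | EMatch t rs => occ_e a t || existsb (occ_r a) rs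
  end
with occ_r (a : nat) (r : rule) : bool :=
  match r with
  | RAll b | RNab b => occ_r a b
  | RArrow p u => occ_p a p || occ_e a u
  end
with occ_p (a : nat) (p : pat) : bool :=
  match p with
  | PVariant _ ps => existsb (occ_p a) ps
  | PNom e | PVar e => occ_e a e
  | PBack q => occ_p a q
  | PArob q e => occ_p a q || occ_e a e
  end.

Fixpoint lc_e (k : nat) (e : expr) : bool :=
  match e with
  | EBVar i => i <? k
  | ENom _ => true
  | ELam b | EFix b | ENew b | EBack b => lc_e (S k) b
  | EApp m n | EArob m n => lc_e k m && lc_e k n
  | ELet m b => lc_e k m && lc_e (S k) b
  | EVariant _ ts => forallb (lc_e k) ts
  | EMatch t rs => lc_e k t && forallb (lc_r k) rs
  end
with lc_r (k : nat) (r : rule) : bool :=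
  match r with
  | RAll b | RNab b => lc_r (S k) b
  | RArrow p u => lc_p k p && lc_e k u
  end
with lc_p (k : nat) (p : pat) : bool :=
  match p with
  | PVariant _ ps => forallb (lc_p k) ps
  | PNom e | PVar e => lc_e k e
  | PBack q => lc_p (S k) q
  | PArob q e => lc_p k q && lc_e k e
  end.

Definition closed_e (e : expr) : Prop := lc_e 0 e = true.
Definition fresh_e (a : nat) (e : expr) : Prop := occ_e a e = false.
Definition fresh_p (a : nat) (p : pat) : Prop := occ_p a p = false.

Inductive matches : expr -> pat -> Prop :=
| M_variant : forall c ts ps,
    Forall2 matches ts ps -> matches (EVariant c ts) (PVariant c ps)
| M_nom : forall a, matches (ENom a) (PNom (ENom a))
| M_var : forall x, matches x (PVar x)
(* pattern backslash:  backslash(\X.t X) matches X\ p X  if  nabla X. t X matches p X *)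
| M_back : forall r q a,
    fresh_e a r -> fresh_p a q ->
    matches (open_e r (ENom a)) (open_p q (ENom a)) ->
    matches (EBack r) (PBack q)
| M_arob : forall t q x r,
    matches (EBack r) q -> t = open_e r x -> matches t (PArob q x).

Inductive clause : expr -> rule -> expr -> Prop :=
| C_all : forall t r u x,
    closed_e x -> clause t (open_r r x) u -> clause t (RAll r) u
| C_arrow : forall t m p u P U,
    matches t P ->
    nom_abs m (RArrow p u) (RArrow P U) ->
    clause t (Nat.iter m RNab (RArrow p u)) U.

Inductive eval : expr -> expr -> Prop :=
| Ev_lam : forall r, eval (ELam r) (ELam r)
| Ev_variant : forall c ts vs,
    Forall2 eval ts vs -> eval (EVariant c ts) (EVariant c vs)
| Ev_new : forall e v a,
    fresh_e a e -> fresh_e a v ->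
    eval (open_e e (ENom a)) v -> eval (ENew e) v
| Ev_app : forall m n r u v,
    eval m (ELam r) -> eval n u -> eval (open_e r u) v -> eval (EApp m n) v
| Ev_let : forall m r u v,
    eval m u -> eval (open_e r u) v -> eval (ELet m r) v
| Ev_fix : forall r v,
    eval (open_e r (EFix r)) v -> eval (EFix r) v
| Ev_arob : forall m x r v,
    eval m (EBack r) -> eval (open_e r x) v -> eval (EArob m x) v
| Ev_back : forall e v a,
    fresh_e a e -> fresh_e a v ->
    eval (open_e e (ENom a)) (open_e v (ENom a)) -> eval (EBack e) (EBack v)
| Ev_match_hit : forall t rl rls u v,
    clause t rl u -> eval u v -> eval (EMatch t (rl :: rls)) v
| Ev_match_miss : forall t rl rls v,
    ~ (exists u, closed_e u /\ clause t rl u) ->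
    eval (EMatch t rls) v -> eval (EMatch t (rl :: rls)) v.

(* Restrictions on match clauses.
   Each bound variable in scope is tagged with a kind:
   KPat    : pattern variable (all) of the clause being checked
   KLoc    : clause-local nominal (nab of the clause, or pattern backslash)
   KNomOut : nominal bound outside the clause (new, backslash, or the nab of
             an enclosing clause, seen from its body)
   KOther  : any other variable (lam, let, fix, pattern variable of an
             enclosing clause seen from its body). *)
Inductive kind := KPat | KLoc | KNomOut | KOther.

Definition kind_at (env : list kind) (i : nat) : kind := nth i env KOther.

Definition demote (k : kind) : kind :=
  match k with KPat => KOther | KLoc => KNomOut | k => k end.

(* restriction (2): r @ X1 .. Xn  (n >= 0) with r a pattern variable and the
   Xi distinct clause-local nominals bound inside the scope of r's binder
   (in de Bruijn terms: index of Xi smaller than index of r). *)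
Fixpoint flex_ok (env : list kind) (q : pat) (args : list nat) : Prop :=
  match q with
  | PVar (EBVar r) =>
      kind_at env r = KPat /\ NoDup args /\
      Forall (fun x => kind_at env x = KLoc /\ x < r) args
  | PArob q' (EBVar x) => flex_ok env q' (x :: args)
  | _ => False
  end.

Fixpoint ok_pat (env : list kind) (p : pat) : Prop :=
  match p with
  | PVariant _ ps =>
      (fix go (l : list pat) : Prop :=
         match l with [] => True | q :: l' => ok_pat env q /\ go l' end) ps
  | PNom (ENom _) => True
  | PNom (EBVar i) => kind_at env i = KLoc \/ kind_at env i = KNomOut
  | PNom _ => False
  | PVar _ => flex_ok env p []
  | PArob _ _ => flex_ok env p []
  | PBack q => ok_pat (KLoc :: env) q
  end.

Fixpoint cnt_e (i : nat) (e : expr) : nat :=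
  match e with
  | EBVar j => if i =? j then 1 else 0
  | ENom _ => 0
  | ELam b | EFix b | ENew b | EBack b => cnt_e (S i) b
  | EApp m n | EArob m n => cnt_e i m + cnt_e i n
  | ELet m b => cnt_e i m + cnt_e (S i) b
  | EVariant _ ts => list_sum (map (cnt_e i) ts)
  | EMatch t rs => cnt_e i t + list_sum (map (cnt_r i) rs)
  end
with cnt_r (i : nat) (r : rule) : nat :=
  match r with
  | RAll b | RNab b => cnt_r (S i) b
  | RArrow p u => cnt_p i p + cnt_e i u
  end
with cnt_p (i : nat) (p : pat) : nat :=
  match p with
  | PVariant _ ps => list_sum (map (cnt_p i) ps)
  | PNom e | PVar e => cnt_e i e
  | PBack q => cnt_p (S i) q
  | PArob q e => cnt_p i q + cnt_e i e
  end.

(* number of rigid occurrences (not in the scope of a pattern @) *)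
Fixpoint rig_p (i : nat) (p : pat) : nat :=
  match p with
  | PVariant _ ps => list_sum (map (rig_p i) ps)
  | PNom e | PVar e => cnt_e i e
  | PBack q => rig_p (S i) q
  | PArob _ _ => 0
  end.

Definition pat_restr (env : list kind) (p : pat) : Prop :=
  forall i, i < length env ->
    (kind_at env i = KPat -> cnt_p i p = 1) /\
    (kind_at env i = KLoc -> 1 <= rig_p i p).

Fixpoint ok_expr (env : list kind) (e : expr) : Prop :=
  match e with
  | EBVar _ | ENom _ => True
  | ELam b | EFix b => ok_expr (KOther :: env) b
  | EApp m n | EArob m n => ok_expr env m /\ ok_expr env n
  | ELet m b => ok_expr env m /\ ok_expr (KOther :: env) b
  | EVariant _ ts =>
      (fix go (l : list expr) : Prop :=
         match l with [] => True | t :: l' => ok_expr env t /\ go l' end) ts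
  | ENew b | EBack b => ok_expr (KNomOut :: env) b
  | EMatch t rs =>
      ok_expr env t /\
      (fix go (l : list rule) : Prop :=
         match l with [] => True | r :: l' => ok_rule env r /\ go l' end) rs
  end
with ok_rule (env : list kind) (r : rule) : Prop :=
  match r with
  | RAll b => ok_rule (KPat :: env) b
  | RNab b => ok_rule (KLoc :: env) b
  | RArrow p u => ok_pat env p /\ pat_restr env p /\ ok_expr (map demote env) u
  end.

(* Main.v *)
(** Two evaluations of the same term may differ in the nominals chosen for
    [new], for the two backslashes and for [nab], and in the instances chosen
    for pattern variables.  The latter two are determined by the scrutinee: the
    rigid occurrences fix the [nab]-bound nominals, and then each pattern
    variable, being applied to distinct nominals that do not occur in it, is
    recovered by abstracting these nominals.  The other choices are harmless
    since all relations are invariant under permutations of nominals.  The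
    fact needed there, that values contain no new nominals, is itself a
    consequence of determinacy and equivariance, so that both are obtained in
    a single induction. *)

From Stdlib Require Import List Arith Bool Lia FinFun.
Import ListNotations.
Require Import Defs.

(** The rules open a clause one [all] at a time, but the instance chosen for an [all] is fixed only
    by the pattern at the very end, so two derivations cannot be compared step by step. A derivation
    of [clause] is therefore flattened into a single list of closed terms substituted into the
    pattern and the body, and determinacy of clauses becomes equality of two such lists that match
    the same scrutinee. That no [nab]-bound nominal occurs in the instance of a pattern variable is
    not a premise of [clause]: it follows because closing removes these nominals from the whole
    pattern, in which every pattern variable occurs. The negative premise of the miss rule shapes
    two further points. Renamings are taken to be involutions, because a clause instance has to be
    carried back through the renaming; and clauses must be shown to preserve closedness, because the
    miss rule excludes closed results only. *)

(** * Induction over the nested mutual syntax *)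

Section SyntaxInd.
Variables (P : expr -> Prop) (Q : rule -> Prop) (T : pat -> Prop).
Hypothesis h_bvar : forall i, P (EBVar i).
Hypothesis h_nom : forall a, P (ENom a).
Hypothesis h_lam : forall b, P b -> P (ELam b).
Hypothesis h_app : forall m n, P m -> P n -> P (EApp m n).
Hypothesis h_let : forall m b, P m -> P b -> P (ELet m b).
Hypothesis h_fix : forall b, P b -> P (EFix b).
Hypothesis h_variant : forall k ts, Forall P ts -> P (EVariant k ts).
Hypothesis h_new : forall b, P b -> P (ENew b).
Hypothesis h_back : forall b, P b -> P (EBack b).
Hypothesis h_arob : forall m x, P m -> P x -> P (EArob m x).
Hypothesis h_match : forall t rs, P t -> Forall Q rs -> P (EMatch t rs).
Hypothesis h_all : forall b, Q b -> Q (RAll b).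
Hypothesis h_nab : forall b, Q b -> Q (RNab b).
Hypothesis h_arrow : forall p u, T p -> P u -> Q (RArrow p u).
Hypothesis h_pvariant : forall k ps, Forall T ps -> T (PVariant k ps).
Hypothesis h_pnom : forall e, P e -> T (PNom e).
Hypothesis h_pvar : forall e, P e -> T (PVar e).
Hypothesis h_pback : forall q, T q -> T (PBack q).
Hypothesis h_parob : forall q e, T q -> P e -> T (PArob q e).

Fixpoint expr_nested_ind (e : expr) : P e :=
  match e with
  | EBVar i => h_bvar i
  | ENom a => h_nom a
  | ELam b => h_lam b (expr_nested_ind b)
  | EApp m n => h_app m n (expr_nested_ind m) (expr_nested_ind n)
  | ELet m b => h_let m b (expr_nested_ind m) (expr_nested_ind b)
  | EFix b => h_fix b (expr_nested_ind b)
  | EVariant k ts => h_variant k ts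
      ((fix go l : Forall P l :=
          match l with
          | [] => Forall_nil _
          | t :: l' => Forall_cons _ (expr_nested_ind t) (go l')
          end) ts)
  | ENew b => h_new b (expr_nested_ind b)
  | EBack b => h_back b (expr_nested_ind b)
  | EArob m x => h_arob m x (expr_nested_ind m) (expr_nested_ind x)
  | EMatch t rs => h_match t rs (expr_nested_ind t)
      ((fix go l : Forall Q l :=
          match l with
          | [] => Forall_nil _
          | r :: l' => Forall_cons _ (rule_nested_ind r) (go l')
          end) rs)
  end
with rule_nested_ind (r : rule) : Q r :=
  match r with
  | RAll b => h_all b (rule_nested_ind b)
  | RNab b => h_nab b (rule_nested_ind b)
  | RArrow p u => h_arrow p u (pat_nested_ind p) (expr_nested_ind u)
  end
with pat_nested_ind (p : pat) : T p :=
  match p with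
  | PVariant k ps => h_pvariant k ps
      ((fix go l : Forall T l :=
          match l with
          | [] => Forall_nil _
          | q :: l' => Forall_cons _ (pat_nested_ind q) (go l')
          end) ps)
  | PNom e => h_pnom e (expr_nested_ind e)
  | PVar e => h_pvar e (expr_nested_ind e)
  | PBack q => h_pback q (pat_nested_ind q)
  | PArob q e => h_parob q e (pat_nested_ind q) (expr_nested_ind e)
  end.

Lemma syntax_ind : (forall e, P e) /\ (forall r, Q r) /\ (forall p, T p).
Proof.
  exact (conj expr_nested_ind (conj rule_nested_ind pat_nested_ind)).
Qed.
End SyntaxInd.

Lemma list_sum_pos {A} (f : A -> nat) (l : list A) :
  1 <= list_sum (map f l) -> exists x, In x l /\ 1 <= f x.
Proof.
  induction l as [|x l IH]; simpl; intros H; [lia|].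
  destruct (f x) eqn:E.
  - destruct IH as [y [Hy Hy']]; [lia|]. eauto.
  - exists x. split; [auto|lia].
Qed.

Lemma list_sum_0 {A} (f : A -> nat) (l : list A) :
  (forall x, In x l -> f x = 0) -> list_sum (map f l) = 0.
Proof.
  induction l as [|x l IH]; simpl; intros H; [reflexivity|].
  rewrite H, IH; auto.
Qed.

Lemma fold_and_Forall {A} (P : A -> Prop) (l : list A) :
  fold_right (fun t Q => P t /\ Q) True l <-> Forall P l.
Proof.
  induction l as [|x l IH]; simpl.
  - split; auto.
  - rewrite IH. split; [intros []; auto|]. intros H; inversion H; auto.
Qed.

(** * Traversals *)

(** A traversal changes a term only at its leaves, so two composites agree once they agree on
    variables and nominals. The commutation laws for opening, closing, renaming and substitution
    below are all instances; the offsets let one traversal skip the variables that the next one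
    fills. *)
Lemma tr_comm f1 g1 f2 g2 f3 g3 f4 g4 d1 d2 d3 d4 :
  (forall c i, tr_e f2 g2 (c + d2) (f1 (c + d1) i)
             = tr_e f4 g4 (c + d4) (f3 (c + d3) i)) ->
  (forall c a, tr_e f2 g2 (c + d2) (g1 (c + d1) a)
             = tr_e f4 g4 (c + d4) (g3 (c + d3) a)) ->
  (forall e c, tr_e f2 g2 (c + d2) (tr_e f1 g1 (c + d1) e)
             = tr_e f4 g4 (c + d4) (tr_e f3 g3 (c + d3) e)) /\
  (forall r c, tr_r f2 g2 (c + d2) (tr_r f1 g1 (c + d1) r)
             = tr_r f4 g4 (c + d4) (tr_r f3 g3 (c + d3) r)) /\
  (forall p c, tr_p f2 g2 (c + d2) (tr_p f1 g1 (c + d1) p)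
             = tr_p f4 g4 (c + d4) (tr_p f3 g3 (c + d3) p)).
Proof.
  intros Hf Hg.
  apply syntax_ind; simpl; intros; try solve [apply Hf | apply Hg];
    rewrite ?map_map; f_equal; auto;
    try match goal with
    | IH : forall c, tr_e _ _ (c + _) (tr_e _ _ _ ?x) = _
      |- tr_e _ _ (S _) (tr_e _ _ _ ?x) = _ => apply (IH (S c))
    | IH : forall c, tr_r _ _ (c + _) (tr_r _ _ _ ?x) = _
      |- tr_r _ _ (S _) (tr_r _ _ _ ?x) = _ => apply (IH (S c))
    | IH : forall c, tr_p _ _ (c + _) (tr_p _ _ _ ?x) = _
      |- tr_p _ _ (S _) (tr_p _ _ _ ?x) = _ => apply (IH (S c))
    end;
    (apply map_ext_Forall; eapply Forall_impl; [|eassumption]; simpl; auto).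
Qed.

(** Together with [keep_nom] this is the identity traversal, which pads a side of [tr_comm] that has
    only one genuine traversal. *)
Definition id_fv (c i : nat) : expr := EBVar i.

Lemma tr_id :
  (forall e c, tr_e id_fv keep_nom c e = e) /\
  (forall r c, tr_r id_fv keep_nom c r = r) /\
  (forall p c, tr_p id_fv keep_nom c p = p).
Proof.
  apply syntax_ind; simpl; intros; f_equal; auto;
    (rewrite <- map_id; apply map_ext_Forall;
     eapply Forall_impl; [|eassumption]; simpl; auto).
Qed.

(** [B] is a switch. With [B := True] the variable functions must agree everywhere and nothing is
    asked of the term; with [B := False] they need to agree only on local variables, and the term
    must be locally closed at the depth. *)
Lemma tr_ext (B : Prop) f g f' g' :
  (forall c i, B \/ i < c -> f c i = f' c i) ->
  (forall e c, B \/ lc_e c e = true ->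
     (forall a, occ_e a e = true -> forall d, g d a = g' d a) ->
     tr_e f g c e = tr_e f' g' c e) /\
  (forall r c, B \/ lc_r c r = true ->
     (forall a, occ_r a r = true -> forall d, g d a = g' d a) ->
     tr_r f g c r = tr_r f' g' c r) /\
  (forall p c, B \/ lc_p c p = true ->
     (forall a, occ_p a p = true -> forall d, g d a = g' d a) ->
     tr_p f g c p = tr_p f' g' c p).
Proof.
  intros Hf.
  apply syntax_ind; simpl; intros;
    repeat match goal with
    | H : _ \/ _ && _ = true |- _ => rewrite andb_true_iff in H
    end;
    try (apply Hf; rewrite Nat.ltb_lt in *; tauto);
    try (match goal with H : forall a, _ -> forall d, g d a = _ |- _ =>
           apply H, Nat.eqb_refl end);
    f_equal;
    try (match goal with IH : forall c, _ -> _ -> _ = _ |- _ =>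
           apply IH; [tauto|intros; match goal with
             H : forall a, _ -> forall d, g d a = _ |- _ => apply H end;
             rewrite ?orb_true_iff; auto] end);
    apply map_ext_in; intros x Hx;
    match goal with IH : Forall _ _ |- _ => rewrite Forall_forall in IH; apply IH end;
    auto;
    try (rewrite forallb_forall in *; intuition; fail);
    intros a Ha d; match goal with
      H : forall a, _ -> forall d, g d a = _ |- _ => apply H end;
    rewrite ?orb_true_iff, existsb_exists; eauto.
Qed.

Lemma occ_tr x f g :
  (forall e c, occ_e x (tr_e f g c e) = true ->
     (exists d i, occ_e x (f d i) = true) \/
     (exists d y, occ_e y e = true /\ occ_e x (g d y) = true)) /\
  (forall r c, occ_r x (tr_r f g c r) = true ->
     (exists d i, occ_e x (f d i) = true) \/
     (exists d y, occ_r y r = true /\ occ_e x (g d y) = true)) /\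
  (forall p c, occ_p x (tr_p f g c p) = true ->
     (exists d i, occ_e x (f d i) = true) \/
     (exists d y, occ_p y p = true /\ occ_e x (g d y) = true)).
Proof.
  apply syntax_ind; simpl; intros; eauto;
    try (right; do 2 eexists; split; [apply Nat.eqb_refl|eassumption]);
    rewrite ?orb_true_iff in *;
    repeat match goal with H : _ \/ _ |- _ => destruct H end;
    try (match goal with
      | IH : forall c, occ_e _ (tr_e _ _ _ ?x) = _ -> _,
        H : occ_e _ (tr_e _ _ _ ?x) = true |- _ => apply IH in H
      | IH : forall c, occ_r _ (tr_r _ _ _ ?x) = _ -> _,
        H : occ_r _ (tr_r _ _ _ ?x) = true |- _ => apply IH in H
      | IH : forall c, occ_p _ (tr_p _ _ _ ?x) = _ -> _,
        H : occ_p _ (tr_p _ _ _ ?x) = true |- _ => apply IH in H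
      end; match goal with H : _ \/ _ |- _ => destruct H as [?|[d [y [? ?]]]] end;
      [left; assumption|right; exists d, y; rewrite ?orb_true_iff; auto]; fail);
    match goal with
    | IH : Forall _ ?l, H : existsb _ (map _ ?l) = true |- _ =>
      apply existsb_exists in H; destruct H as [z [Hz Hx]];
      apply in_map_iff in Hz; destruct Hz as [w [<- Hw]];
      rewrite Forall_forall in IH; apply (IH w Hw) in Hx;
      destruct Hx as [Hx|[d [y [Hy Hx]]]]; [auto|right; exists d, y];
      rewrite ?orb_true_iff, existsb_exists; split; eauto
    end.
Qed.

Lemma occ_tr_intro x y f g :
  (forall d, occ_e x (g d y) = true) ->
  (forall e c, occ_e y e = true -> occ_e x (tr_e f g c e) = true) /\
  (forall r c, occ_r y r = true -> occ_r x (tr_r f g c r) = true) /\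
  (forall p c, occ_p y p = true -> occ_p x (tr_p f g c p) = true).
Proof.
  intros Hg.
  apply syntax_ind; simpl; intros; try discriminate; auto;
    try (apply Nat.eqb_eq in H; subst; auto; fail);
    rewrite ?orb_true_iff in *; try (intuition auto; fail);
    rewrite existsb_exists in *;
    repeat match goal with
    | H : _ \/ _ |- _ => destruct H; [left; auto; fail|]
    end;
    try right;
    match goal with
    | IH : Forall _ ?l, H : ex _ |- _ =>
      destruct H as [z [Hz Hx]]; rewrite Forall_forall in IH;
      eexists; split; [apply in_map; exact Hz|auto]
    end.
Qed.

(** Finiteness of support, stated as a bound so that sums of bounds yield a nominal fresh for
    finitely many terms. *)
Lemma occ_bound :
  (forall e, exists n, forall a, occ_e a e = true -> a < n) /\
  (forall r, exists n, forall a, occ_r a r = true -> a < n) /\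
  (forall p, exists n, forall a, occ_p a p = true -> a < n).
Proof.
  assert (L : forall A (occ : nat -> A -> bool) (l : list A),
    Forall (fun x => exists n, forall a, occ a x = true -> a < n) l ->
    exists n, forall a, existsb (occ a) l = true -> a < n).
  { intros A occ l H. induction H as [|x l [n Hn] _ [m Hm]].
    - exists 0. discriminate.
    - exists (n + m). simpl. intros a Ha. apply orb_true_iff in Ha.
      destruct Ha as [Ha|Ha]; [apply Hn in Ha|apply Hm in Ha]; lia. }
  assert (C : forall f g : nat -> bool,
    (exists n, forall a, f a = true -> a < n) ->
    (exists n, forall a, g a = true -> a < n) ->
    exists n, forall a, f a || g a = true -> a < n).
  { intros f g [n Hn] [m Hm]. exists (n + m). intros a Ha.
    apply orb_true_iff in Ha.
    destruct Ha as [Ha|Ha]; [apply Hn in Ha|apply Hm in Ha]; lia. }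
  apply syntax_ind; simpl; intros; auto.
  - exists 0. discriminate.
  - exists (S a). intros b Hb. apply Nat.eqb_eq in Hb. lia.
Qed.

Lemma fresh_exists (es : list expr) (ps : list pat) :
  exists a, Forall (fresh_e a) es /\ Forall (fresh_p a) ps.
Proof.
  destruct occ_bound as [Be [_ Bp]].
  assert (He : exists n, forall a, n <= a -> Forall (fresh_e a) es).
  { induction es as [|e es [n Hn]]; [exists 0; auto|].
    destruct (Be e) as [m Hm]. exists (n + m). intros a Ha.
    constructor; [|apply Hn; lia].
    apply not_true_iff_false. intros H. apply Hm in H. lia. }
  assert (Hp : exists n, forall a, n <= a -> Forall (fresh_p a) ps).
  { induction ps as [|p ps [n Hn]]; [exists 0; auto|].
    destruct (Bp p) as [m Hm]. exists (n + m). intros a Ha.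
    constructor; [|apply Hn; lia].
    apply not_true_iff_false. intros H. apply Hm in H. lia. }
  destruct He as [n Hn], Hp as [m Hm]. exists (n + m).
  split; [apply Hn|apply Hm]; lia.
Qed.

(** * Opening with a nominal *)

Lemma fresh_open_e a b e : a <> b -> fresh_e a e -> fresh_e a (open_e e (ENom b)).
Proof.
  intros Hab He. apply not_true_iff_false. intros H.
  apply (proj1 (occ_tr _ _ _)) in H.
  destruct H as [[d [i H]]|[d [y [Hy H]]]].
  - unfold open_fv in H. destruct (i <? d); [discriminate|].
    destruct (i =? d); [|discriminate].
    simpl in H. apply Nat.eqb_eq in H. contradiction.
  - simpl in H. apply Nat.eqb_eq in H. subst y. congruence.
Qed.

Lemma fresh_open_e_inv a s e : fresh_e a (open_e e s) -> fresh_e a e.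
Proof.
  intros He. apply not_true_iff_false. intros H.
  apply (proj1 (occ_tr_intro a a (open_fv s) keep_nom
                  (fun _ => Nat.eqb_refl a)) e 0) in H.
  unfold fresh_e, open_e in He. congruence.
Qed.

(** Freshness of [a] ensures that closing captures only the occurrences created by the opening. This
    gives injectivity of opening, which is what recovers an abstraction from its instance. *)
Lemma close_open a e :
  fresh_e a e -> tr_e (close_fv 1) (close_fn [a]) 0 (open_e e (ENom a)) = e.
Proof.
  intros He. unfold open_e.
  rewrite <- (proj1 tr_id e 0) at 2.
  transitivity (tr_e id_fv keep_nom 0 (tr_e id_fv (close_fn [a]) 0 e)).
  (* The variables are already restored here; what remains is the action of closing on the nominals
     of [e] itself, which is trivial by freshness. *)
  - assert (H := tr_comm (open_fv (ENom a)) keep_nom (close_fv 1) (close_fn [a])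
                   id_fv (close_fn [a]) id_fv keep_nom 0 0 0 0).
    refine (proj1 (H _ _) e 0); intros c i; rewrite !Nat.add_0_r.
    + unfold open_fv. destruct (Nat.ltb_spec i c); simpl; unfold close_fv, close_fn.
      * destruct (Nat.ltb_spec i c); [reflexivity|lia].
      * destruct (Nat.eqb_spec i c); simpl.
        -- rewrite Nat.eqb_refl. unfold id_fv. f_equal. lia.
        -- destruct (Nat.ltb_spec (pred i) c); [lia|]. unfold id_fv. f_equal. lia.
    + simpl. unfold close_fn. simpl. destruct (i =? a); reflexivity.
  - rewrite (proj1 tr_id). apply (proj1 (tr_ext True _ _ _ _ (fun _ _ _ => eq_refl))).
    + auto.
    + intros b Hb d. unfold close_fn. simpl.
      destruct (Nat.eqb_spec b a); [|reflexivity].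
      unfold fresh_e in He. congruence.
Qed.

Lemma open_nom_inj a e e' :
  fresh_e a e -> fresh_e a e' ->
  open_e e (ENom a) = open_e e' (ENom a) -> e = e'.
Proof.
  intros He He' H.
  rewrite <- (close_open a e He), <- (close_open a e' He'), H. reflexivity.
Qed.

(** * Equivariance *)

Definition ren_fn (f : nat -> nat) (c a : nat) : expr := ENom (f a).
Definition ren_e (f : nat -> nat) : expr -> expr := tr_e id_fv (ren_fn f) 0.
Definition ren_r (f : nat -> nat) : rule -> rule := tr_r id_fv (ren_fn f) 0.
Definition ren_p (f : nat -> nat) : pat -> pat := tr_p id_fv (ren_fn f) 0.

(** The leaf functions of a renaming ignore the depth. The lemma folds the traversals that [simpl]
    leaves under binders back into renamings. *)
Lemma ren_depth f :
  (forall e c, tr_e id_fv (ren_fn f) c e = ren_e f e) /\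
  (forall r c, tr_r id_fv (ren_fn f) c r = ren_r f r) /\
  (forall p c, tr_p id_fv (ren_fn f) c p = ren_p f p).
Proof.
  unfold ren_e, ren_r, ren_p.
  apply syntax_ind; simpl; intros; auto; f_equal;
    try match goal with IH : forall c, _ = _ |- _ =>
      etransitivity; [apply IH|symmetry; apply IH] end;
    (apply map_ext_Forall; eapply Forall_impl; [|eassumption]; simpl; auto).
Qed.

Lemma occ_ren f (Hinj : forall x y, f x = f y -> x = y) a :
  (forall e, occ_e (f a) (ren_e f e) = occ_e a e) /\
  (forall p, occ_p (f a) (ren_p f p) = occ_p a p).
Proof.
  assert (I : forall d, occ_e (f a) (ren_fn f d a) = true)
    by (intros; apply Nat.eqb_refl).
  split; intros x; apply eq_iff_eq_true; split; intros H.
  - apply (proj1 (occ_tr _ _ _)) in H.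
    destruct H as [[d [i H]]|[d [y [Hy H]]]]; [discriminate|].
    apply Nat.eqb_eq, Hinj in H. subst; auto.
  - apply (proj1 (occ_tr_intro _ _ _ _ I)); auto.
  - apply (proj2 (proj2 (occ_tr _ _ _))) in H.
    destruct H as [[d [i H]]|[d [y [Hy H]]]]; [discriminate|].
    apply Nat.eqb_eq, Hinj in H. subst; auto.
  - apply (proj2 (proj2 (occ_tr_intro _ _ _ _ I))); auto.
Qed.

Lemma ren_lift f n s c :
  tr_e id_fv (ren_fn f) c (lift_e n s) = lift_e n (ren_e f s).
Proof.
  rewrite (proj1 (ren_depth f)). unfold lift_e, ren_e.
  assert (H := tr_comm (lift_fv n) keep_nom id_fv (ren_fn f)
                 id_fv (ren_fn f) (lift_fv n) keep_nom 0 0 0 0).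
  refine (proj1 (H _ _) s 0); intros d i; simpl; [|reflexivity].
  unfold lift_fv. destruct (_ <? _); reflexivity.
Qed.

Lemma ren_open f s :
  (forall e, ren_e f (open_e e s) = open_e (ren_e f e) (ren_e f s)) /\
  (forall r, ren_r f (open_r r s) = open_r (ren_r f r) (ren_e f s)) /\
  (forall p, ren_p f (open_p p s) = open_p (ren_p f p) (ren_e f s)).
Proof.
  unfold open_e, open_r, open_p, ren_e at 1 2, ren_r, ren_p.
  assert (H := tr_comm (open_fv s) keep_nom id_fv (ren_fn f) id_fv (ren_fn f)
                 (open_fv (ren_e f s)) keep_nom 0 0 0 0).
  destruct H as [He [Hr Hp]].
  - intros c i. simpl. rewrite !Nat.add_0_r. unfold open_fv.
    destruct (i <? c); [reflexivity|].
    destruct (i =? c); [apply ren_lift|reflexivity].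
  - reflexivity.
  - split; [|split]; intros x; [apply (He x 0)|apply (Hr x 0)|apply (Hp x 0)].
Qed.

Lemma index_of_map f (Hinj : forall x y, f x = f y -> x = y) a cs :
  index_of (f a) (map f cs) = index_of a cs.
Proof.
  induction cs as [|c cs IH]; simpl; [reflexivity|]. rewrite IH.
  destruct (Nat.eqb_spec a c), (Nat.eqb_spec (f a) (f c)); subst; auto.
  - contradiction.
  - apply Hinj in e. contradiction.
Qed.

Lemma ren_close f (Hinj : forall x y, f x = f y -> x = y) cs r :
  ren_r f (close_r cs r) = close_r (map f cs) (ren_r f r).
Proof.
  unfold close_r, ren_r. rewrite length_map.
  assert (H := tr_comm (close_fv (length cs)) (close_fn cs) id_fv (ren_fn f)
                 id_fv (ren_fn f) (close_fv (length cs)) (close_fn (map f cs)) 0 0 0 0).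
  destruct H as [_ [Hr _]].
  - intros c i. simpl. unfold close_fv. destruct (_ <? _); reflexivity.
  - intros c a. simpl. unfold close_fn. rewrite index_of_map, length_map by auto.
    destruct (index_of a cs); reflexivity.
  - apply (Hr r 0).
Qed.

Lemma ren_lc f :
  (forall e k, lc_e k (ren_e f e) = lc_e k e) /\
  (forall r k, lc_r k (ren_r f r) = lc_r k r) /\
  (forall p k, lc_p k (ren_p f p) = lc_p k p).
Proof.
  assert (F : forall A (h : A -> A) (g g' : A -> bool) l,
    Forall (fun x => g (h x) = g' x) l -> forallb g (map h l) = forallb g' l).
  { intros A h g g' l H. induction H; simpl; congruence. }
  unfold ren_e, ren_r, ren_p.
  apply syntax_ind; simpl; intros; auto;
    rewrite ?(proj1 (ren_depth f)), ?(proj1 (proj2 (ren_depth f))),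
      ?(proj2 (proj2 (ren_depth f)));
    unfold ren_e, ren_r, ren_p; try congruence;
    (try apply (f_equal2 andb); auto;
     apply F; eapply Forall_impl; [|eassumption]; simpl; auto).
Qed.

Lemma ren_involutive f (Hf : forall x, f (f x) = x) :
  (forall e, ren_e f (ren_e f e) = e) /\ (forall r, ren_r f (ren_r f r) = r).
Proof.
  assert (H := tr_comm id_fv (ren_fn f) id_fv (ren_fn f) id_fv keep_nom
                 id_fv keep_nom 0 0 0 0).
  destruct H as [He [Hr _]].
  - reflexivity.
  - intros. simpl. unfold ren_fn, keep_nom. rewrite Hf. reflexivity.
  - unfold ren_e, ren_r. split; intros x.
    + etransitivity; [apply (He x 0)|]. rewrite !(proj1 tr_id). reflexivity.
    + etransitivity; [apply (Hr x 0)|].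
      rewrite !(proj1 (proj2 tr_id)). reflexivity.
Qed.

Lemma ren_fixed f e :
  (forall a, occ_e a e = true -> f a = a) -> ren_e f e = e.
Proof.
  intros H. rewrite <- (proj1 tr_id e 0) at 2.
  apply (proj1 (tr_ext True _ _ _ _ (fun _ _ _ => eq_refl))); auto.
  intros a Ha d. unfold ren_fn, keep_nom. rewrite H; auto.
Qed.

Definition swap (a b x : nat) : nat :=
  if x =? a then b else if x =? b then a else x.

Lemma swap_involutive a b x : swap a b (swap a b x) = x.
Proof.
  unfold swap. destruct (Nat.eqb_spec x a), (Nat.eqb_spec x b);
  repeat (match goal with |- context [?u =? ?v] => destruct (Nat.eqb_spec u v) end);
    congruence.
Qed.

Lemma swap_l a b : swap a b a = b.
Proof. unfold swap. rewrite Nat.eqb_refl. reflexivity. Qed.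

Lemma swap_r a b : swap a b b = a.
Proof.
  unfold swap. rewrite Nat.eqb_refl. destruct (Nat.eqb_spec b a); auto.
Qed.

Lemma swap_fresh a b e : fresh_e a e -> fresh_e b e -> ren_e (swap a b) e = e.
Proof.
  intros Ha Hb. apply ren_fixed. intros x Hx. unfold swap, fresh_e in *.
  destruct (Nat.eqb_spec x a), (Nat.eqb_spec x b); congruence.
Qed.

Lemma involutive_inj (f : nat -> nat) :
  (forall x, f (f x) = x) -> forall x y, f x = f y -> x = y.
Proof. intros H x y E. rewrite <- (H x), E, H. reflexivity. Qed.

(** * Induction principles for matching and evaluation *)

Section MatchesInd.
Variable P : expr -> pat -> Prop.
Hypothesis h_variant : forall c ts ps,
  Forall2 matches ts ps -> Forall2 P ts ps -> P (EVariant c ts) (PVariant c ps).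
Hypothesis h_nom : forall a, P (ENom a) (PNom (ENom a)).
Hypothesis h_var : forall x, P x (PVar x).
Hypothesis h_back : forall r q a,
  fresh_e a r -> fresh_p a q ->
  matches (open_e r (ENom a)) (open_p q (ENom a)) ->
  P (open_e r (ENom a)) (open_p q (ENom a)) -> P (EBack r) (PBack q).
Hypothesis h_arob : forall t q x r,
  matches (EBack r) q -> P (EBack r) q -> t = open_e r x -> P t (PArob q x).

Fixpoint matches_nested_ind t p (H : matches t p) : P t p :=
  match H in matches t p return P t p with
  | M_variant c ts ps F => h_variant c ts ps F
      ((fix go ts ps (F : Forall2 matches ts ps) : Forall2 P ts ps :=
          match F in Forall2 _ ts ps return Forall2 P ts ps with
          | Forall2_nil _ => Forall2_nil _
          | Forall2_cons _ _ h F' =>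
              Forall2_cons _ _ (matches_nested_ind _ _ h) (go _ _ F')
          end) ts ps F)
  | M_nom a => h_nom a
  | M_var x => h_var x
  | M_back r q a h1 h2 h => h_back r q a h1 h2 h (matches_nested_ind _ _ h)
  | M_arob t q x r h E => h_arob t q x r h (matches_nested_ind _ _ h) E
  end.
End MatchesInd.

Section EvalInd.
Variable P : expr -> expr -> Prop.
Hypothesis h_lam : forall r, P (ELam r) (ELam r).
Hypothesis h_variant : forall c ts vs,
  Forall2 eval ts vs -> Forall2 P ts vs -> P (EVariant c ts) (EVariant c vs).
Hypothesis h_new : forall e v a,
  fresh_e a e -> fresh_e a v ->
  eval (open_e e (ENom a)) v -> P (open_e e (ENom a)) v -> P (ENew e) v.
Hypothesis h_app : forall m n r u v,
  eval m (ELam r) -> P m (ELam r) -> eval n u -> P n u ->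
  eval (open_e r u) v -> P (open_e r u) v -> P (EApp m n) v.
Hypothesis h_let : forall m r u v,
  eval m u -> P m u -> eval (open_e r u) v -> P (open_e r u) v -> P (ELet m r) v.
Hypothesis h_fix : forall r v,
  eval (open_e r (EFix r)) v -> P (open_e r (EFix r)) v -> P (EFix r) v.
Hypothesis h_arob : forall m x r v,
  eval m (EBack r) -> P m (EBack r) ->
  eval (open_e r x) v -> P (open_e r x) v -> P (EArob m x) v.
Hypothesis h_back : forall e v a,
  fresh_e a e -> fresh_e a v ->
  eval (open_e e (ENom a)) (open_e v (ENom a)) ->
  P (open_e e (ENom a)) (open_e v (ENom a)) -> P (EBack e) (EBack v).
Hypothesis h_hit : forall t rl rls u v,
  clause t rl u -> eval u v -> P u v -> P (EMatch t (rl :: rls)) v.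
Hypothesis h_miss : forall t rl rls v,
  ~ (exists u, closed_e u /\ clause t rl u) ->
  eval (EMatch t rls) v -> P (EMatch t rls) v -> P (EMatch t (rl :: rls)) v.

Fixpoint eval_nested_ind e v (H : eval e v) : P e v :=
  match H in eval e v return P e v with
  | Ev_lam r => h_lam r
  | Ev_variant c ts vs F => h_variant c ts vs F
      ((fix go ts vs (F : Forall2 eval ts vs) : Forall2 P ts vs :=
          match F in Forall2 _ ts vs return Forall2 P ts vs with
          | Forall2_nil _ => Forall2_nil _
          | Forall2_cons _ _ h F' =>
              Forall2_cons _ _ (eval_nested_ind _ _ h) (go _ _ F')
          end) ts vs F)
  | Ev_new e v a h1 h2 h => h_new e v a h1 h2 h (eval_nested_ind _ _ h)
  | Ev_app m n r u v h1 h2 h3 =>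
      h_app m n r u v h1 (eval_nested_ind _ _ h1) h2 (eval_nested_ind _ _ h2)
        h3 (eval_nested_ind _ _ h3)
  | Ev_let m r u v h1 h2 =>
      h_let m r u v h1 (eval_nested_ind _ _ h1) h2 (eval_nested_ind _ _ h2)
  | Ev_fix r v h => h_fix r v h (eval_nested_ind _ _ h)
  | Ev_arob m x r v h1 h2 =>
      h_arob m x r v h1 (eval_nested_ind _ _ h1) h2 (eval_nested_ind _ _ h2)
  | Ev_back e v a h1 h2 h => h_back e v a h1 h2 h (eval_nested_ind _ _ h)
  | Ev_match_hit t rl rls u v c h => h_hit t rl rls u v c h (eval_nested_ind _ _ h)
  | Ev_match_miss t rl rls v n h => h_miss t rl rls v n h (eval_nested_ind _ _ h)
  end.
End EvalInd.

(** * Equivariance of matching, clauses and evaluation *)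

Lemma Forall2_map {A B} (R : A -> B -> Prop) (f : A -> A) (g : B -> B) l l' :
  Forall2 (fun x y => R (f x) (g y)) l l' -> Forall2 R (map f l) (map g l').
Proof. induction 1; simpl; auto. Qed.

Lemma matches_ren f (Hf : forall x, f (f x) = x) t p :
  matches t p -> matches (ren_e f t) (ren_p f p).
Proof.
  assert (Hinj := involutive_inj f Hf).
  induction 1 as [c ts ps _ IH|a|x|r q a Hr Hq _ IH|t q x r _ IH ->]
    using matches_nested_ind; try constructor.
  - apply Forall2_map. exact IH.
  - unfold ren_e, ren_p; simpl.
    rewrite (proj1 (ren_depth f)), (proj2 (proj2 (ren_depth f))).
    rewrite (proj1 (ren_open _ _)), (proj2 (proj2 (ren_open _ _))) in IH.
    (* The witness nominal is renamed along with the terms; injectivity of [f] keeps it fresh. *)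
    apply M_back with (a := f a); auto.
    + unfold fresh_e. rewrite (proj1 (occ_ren f Hinj a)). exact Hr.
    + unfold fresh_p. rewrite (proj2 (occ_ren f Hinj a)). exact Hq.
  - rewrite (proj1 (ren_open _ _)). simpl. apply M_arob with (r := ren_e f r); auto.
    unfold ren_e in IH at 1; simpl in IH.
    rewrite (proj1 (ren_depth f)) in IH. exact IH.
Qed.

Lemma ren_iter_RNab f m p u :
  ren_r f (Nat.iter m RNab (RArrow p u)) =
  Nat.iter m RNab (RArrow (ren_p f p) (ren_e f u)).
Proof.
  induction m as [|m IH]; simpl; [reflexivity|].
  rewrite <- IH. unfold ren_r at 1. simpl.
  rewrite (proj1 (proj2 (ren_depth f))). reflexivity.
Qed.

Lemma clause_ren f (Hf : forall x, f (f x) = x) t r u :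
  clause t r u -> clause (ren_e f t) (ren_r f r) (ren_e f u).
Proof.
  assert (Hinj := involutive_inj f Hf).
  induction 1 as [t r u x Hx _ IH|t m p u P U HM [cs [Hl [Hn Hc]]]].
  - unfold ren_r; simpl. rewrite (proj1 (proj2 (ren_depth f))).
    apply C_all with (x := ren_e f x).
    + unfold closed_e. rewrite (proj1 (ren_lc f)). exact Hx.
    + rewrite (proj1 (proj2 (ren_open _ _))) in IH. exact IH.
  - rewrite ren_iter_RNab. apply C_arrow with (P := ren_p f P).
    + apply matches_ren; auto.
    + exists (map f cs). rewrite length_map. split; [auto|]. split.
      * apply Injective_map_NoDup; auto.
      * change (ren_r f (RArrow p u) = close_r (map f cs) (ren_r f (RArrow P U))).
        rewrite Hc. apply ren_close; auto.
Qed.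

Lemma eval_ren f (Hf : forall x, f (f x) = x) e v :
  eval e v -> eval (ren_e f e) (ren_e f v).
Proof.
  assert (Hinj := involutive_inj f Hf).
  induction 1 as [r|c ts vs _ IH|e v a He Hv _ IH|m n r u v _ IH1 _ IH2 _ IH3
    |m r u v _ IH1 _ IH2|r v _ IH|m x r v _ IH1 _ IH2|e v a He Hv _ IH
    |t rl rls u v HC _ IH|t rl rls v HN _ IH] using eval_nested_ind;
    rewrite ?(proj1 (ren_open _ _)) in *; unfold ren_e in *; simpl in *;
    rewrite ?(proj1 (ren_depth f)) in *.
  - constructor.
  - constructor. apply Forall2_map. exact IH.
  - apply Ev_new with (a := f a); auto; unfold fresh_e;
      rewrite (proj1 (occ_ren f Hinj a)); assumption.
  - eapply Ev_app; eauto.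
  - eapply Ev_let; eauto.
  - apply Ev_fix; auto.
  - eapply Ev_arob; eauto.
  - apply Ev_back with (a := f a); auto; unfold fresh_e;
      rewrite (proj1 (occ_ren f Hinj a)); assumption.
  - eapply Ev_match_hit; [|exact IH]. apply clause_ren; auto.
  (* The premise is negative, so a clause instance for the renamed rule is renamed back; [f] serves
     as its own inverse. *)
  - eapply Ev_match_miss; [|exact IH]. intros [u [Hu HC]]. apply HN.
    exists (ren_e f u). split.
    + unfold closed_e. rewrite (proj1 (ren_lc f)). exact Hu.
    + rewrite <- (proj1 (ren_involutive f Hf) t),
        <- (proj2 (ren_involutive f Hf) rl).
      apply clause_ren; auto.
Qed.

(** * Simultaneous substitution of closed terms *)

(* Meant for closed entries of [s], which need no lifting. *)
Definition sub_fv (s : list expr) (c i : nat) : expr :=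
  if i <? c then EBVar i else nth (i - c) s (EBVar (i - length s)).

Notation sub_e s := (tr_e (sub_fv s) keep_nom).
Notation sub_r s := (tr_r (sub_fv s) keep_nom).
Notation sub_p s := (tr_p (sub_fv s) keep_nom).

Lemma sub_fv_nth s i d : i < length s -> sub_fv s 0 i = nth i s d.
Proof.
  intros H. unfold sub_fv. simpl. rewrite Nat.sub_0_r. apply nth_indep, H.
Qed.

(** The default of [nth] in [sub_fv] is the outer variable lowered by the length of the list, so the
    two cases are an index within range and one beyond it. *)
Lemma sub_fv_ge s c i :
  Forall closed_e s -> c <= i ->
  (In (sub_fv s c i) s /\ i < c + length s) \/
  (sub_fv s c i = EBVar (i - length s) /\ c + length s <= i).
Proof.
  intros Hs Hi. unfold sub_fv. destruct (Nat.ltb_spec i c); [lia|].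
  destruct (Nat.lt_ge_cases (i - c) (length s)).
  - left. split; [apply nth_In; assumption|lia].
  - right. rewrite nth_overflow by assumption. split; [reflexivity|lia].
Qed.

Lemma lc_mono :
  (forall e k d, lc_e k e = true -> k <= d -> lc_e d e = true) /\
  (forall r k d, lc_r k r = true -> k <= d -> lc_r d r = true) /\
  (forall p k d, lc_p k p = true -> k <= d -> lc_p d p = true).
Proof.
  apply syntax_ind; simpl; intros; auto;
    rewrite ?andb_true_iff, ?Nat.ltb_lt in *;
    repeat match goal with
    | H : _ /\ _ |- _ => destruct H
    | |- _ /\ _ => split
    end; try lia;
    try match goal with
    | IH : forall k d, _ -> _ -> lc_e _ ?x = true |- lc_e _ ?x = true =>
      eapply IH; [eassumption|lia]
    | IH : forall k d, _ -> _ -> lc_r _ ?x = true |- lc_r _ ?x = true =>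
      eapply IH; [eassumption|lia]
    | IH : forall k d, _ -> _ -> lc_p _ ?x = true |- lc_p _ ?x = true =>
      eapply IH; [eassumption|lia]
    end;
    rewrite forallb_forall in *; rewrite Forall_forall in *; eauto.
Qed.

Lemma closed_tr f c e :
  (forall d i, i < d -> f d i = EBVar i) ->
  closed_e e -> tr_e f keep_nom c e = e.
Proof.
  intros Hf He. rewrite <- (proj1 tr_id e c) at 2.
  (* With [B := False] agreement is required only below the depth, where all variables of a closed
     term lie. *)
  apply (proj1 (tr_ext False f keep_nom id_fv keep_nom
                  (fun d i H => match H with
                                | or_introl F => match F with end
                                | or_intror H' => Hf d i H'
                                end))); auto.
  right. eapply (proj1 lc_mono); [exact He|lia].
Qed.

Lemma sub_closed s c e : closed_e e -> sub_e s c e = e.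
Proof.
  apply closed_tr. intros d i H. unfold sub_fv.
  destruct (Nat.ltb_spec i d); [reflexivity|lia].
Qed.

(** [open_fv] lifts the inserted term past local binders and [sub_fv] does not; on a closed term
    lifting is the identity. *)
Lemma open_sub s :
  closed_e s ->
  (forall e, open_e e s = sub_e [s] 0 e) /\
  (forall r, open_r r s = sub_r [s] 0 r) /\
  (forall p, open_p p s = sub_p [s] 0 p).
Proof.
  intros Hs. unfold open_e, open_r, open_p.
  assert (H := tr_ext True (open_fv s) keep_nom (sub_fv [s]) keep_nom).
  destruct H as [He [Hr Hp]].
  - intros c i _. unfold open_fv, sub_fv.
    destruct (Nat.ltb_spec i c); [reflexivity|].
    destruct (Nat.eqb_spec i c) as [->|Hic].
    + rewrite Nat.sub_diag. simpl. unfold lift_e. apply closed_tr; [|exact Hs].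
      intros d j Hj. unfold lift_fv. destruct (Nat.ltb_spec j d); [reflexivity|lia].
    + rewrite nth_overflow by (simpl; lia). f_equal. simpl. lia.
  - split; [|split]; auto.
Qed.

(** Merges successive openings into one list, with [s1] for the inner variables. The entries of [s2]
    are closed, hence untouched by the later substitution of [s1]. *)
Lemma sub_sub s1 s2 :
  Forall closed_e s2 ->
  (forall e, sub_e s1 0 (sub_e s2 (length s1) e) = sub_e (s1 ++ s2) 0 e) /\
  (forall r, sub_r s1 0 (sub_r s2 (length s1) r) = sub_r (s1 ++ s2) 0 r) /\
  (forall p, sub_p s1 0 (sub_p s2 (length s1) p) = sub_p (s1 ++ s2) 0 p).
Proof.
  intros Hs.
  assert (H := tr_comm (sub_fv s2) keep_nom (sub_fv s1) keep_nom
                 (sub_fv (s1 ++ s2)) keep_nom id_fv keep_nom (length s1) 0 0 0).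
  destruct H as [He [Hr Hp]].
  - intros c i. rewrite (proj1 tr_id), !Nat.add_0_r.
    destruct (Nat.lt_ge_cases i (c + length s1)) as [Hi|Hi].
    + unfold sub_fv at 2. destruct (Nat.ltb_spec i (c + length s1)); [|lia].
      simpl. unfold sub_fv. destruct (Nat.ltb_spec i c); [reflexivity|].
      rewrite app_nth1 by lia. apply nth_indep. lia.
    + destruct (sub_fv_ge s2 _ i Hs Hi) as [[Hin Hlt]|[-> Hge]].
      * rewrite sub_closed by (rewrite Forall_forall in Hs; auto).
        unfold sub_fv.
        destruct (Nat.ltb_spec i (c + length s1)), (Nat.ltb_spec i c); try lia.
        rewrite app_nth2 by lia.
        replace (i - (c + length s1)) with (i - c - length s1) by lia.
        apply nth_indep. lia.
      * simpl. unfold sub_fv.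
        destruct (Nat.ltb_spec (i - length s2) c), (Nat.ltb_spec i c); try lia.
        rewrite !nth_overflow by (rewrite ?length_app; lia).
        rewrite length_app. f_equal. lia.
  - reflexivity.
  - split; [|split]; intros x;
      [rewrite <- (proj1 tr_id (sub_e (s1 ++ s2) 0 x) 0); apply (He x 0)
      |rewrite <- (proj1 (proj2 tr_id) (sub_r (s1 ++ s2) 0 x) 0); apply (Hr x 0)
      |rewrite <- (proj2 (proj2 tr_id) (sub_p (s1 ++ s2) 0 x) 0); apply (Hp x 0)].
Qed.

Lemma sub_nil :
  (forall e c, sub_e [] c e = e) /\
  (forall r c, sub_r [] c r = r) /\
  (forall p c, sub_p [] c p = p).
Proof.
  assert (H := tr_ext True (sub_fv []) keep_nom id_fv keep_nom).
  destruct H as [He [Hr Hp]].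
  - intros c i _. unfold sub_fv. destruct (i <? c); [reflexivity|].
    rewrite nth_overflow by (simpl; lia). simpl. rewrite Nat.sub_0_r. reflexivity.
  - split; [|split]; intros x c; rewrite ?He, ?Hr, ?Hp; auto; apply tr_id.
Qed.

Lemma index_of_nth a cs j : index_of a cs = Some j -> nth_error cs j = Some a.
Proof.
  revert j; induction cs as [|c cs IH]; simpl; intros j H; [discriminate|].
  destruct (Nat.eqb_spec a c) as [->|_].
  - injection H as <-. reflexivity.
  - destruct (index_of a cs); [|discriminate]. injection H as <-. simpl. auto.
Qed.

Lemma index_of_None a cs : index_of a cs = None -> ~ In a cs.
Proof.
  induction cs as [|c cs IH]; simpl; intros H; [auto|].
  destruct (Nat.eqb_spec a c); [discriminate|].
  destruct (index_of a cs); [discriminate|]. intuition.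
Qed.

(** The list is reversed because [close_r] makes the first nominal the outermost binder, that is,
    the largest index. *)
Lemma sub_close cs r : sub_r (map ENom (rev cs)) 0 (close_r cs r) = r.
Proof.
  unfold close_r.
  transitivity (tr_r id_fv keep_nom 0 (tr_r id_fv keep_nom 0 r));
    [|rewrite !(proj1 (proj2 tr_id)); reflexivity].
  assert (H := tr_comm (close_fv (length cs)) (close_fn cs)
                 (sub_fv (map ENom (rev cs))) keep_nom
                 id_fv keep_nom id_fv keep_nom 0 0 0 0).
  refine (proj1 (proj2 (H _ _)) r 0); intros c i; rewrite Nat.add_0_r; simpl.
  - unfold close_fv. destruct (Nat.ltb_spec i c); simpl; unfold sub_fv.
    + destruct (Nat.ltb_spec i c); [reflexivity|lia].
    + destruct (Nat.ltb_spec (i + length cs) c); [lia|].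
      rewrite nth_overflow; rewrite length_map, length_rev; [|lia].
      unfold id_fv. f_equal. lia.
  - unfold close_fn. destruct (index_of i cs) as [j|] eqn:E; [|reflexivity].
    apply index_of_nth in E.
    assert (Hj : j < length cs) by (apply nth_error_Some; congruence).
    simpl. unfold sub_fv.
    destruct (Nat.ltb_spec (c + (length cs - 1 - j)) c); [lia|].
    rewrite (nth_indep _ _ (ENom 0)) by (rewrite length_map, length_rev; lia).
    rewrite map_nth, rev_nth by lia. unfold keep_nom. f_equal.
    replace (length cs - S _) with j by lia.
    apply nth_error_nth, E.
Qed.

(** Closing captures every occurrence of a listed nominal. All freshness of [nab]-bound nominals
    originates here. *)
Lemma close_fresh cs a r : In a cs -> occ_r a (close_r cs r) = false.
Proof.
  intros Ha. apply not_true_iff_false. intros H.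
  apply (proj1 (proj2 (occ_tr _ _ _))) in H.
  destruct H as [[d [i H]]|[d [y [_ H]]]].
  - unfold close_fv in H. destruct (i <? d); discriminate.
  - unfold close_fn in H. destruct (index_of y cs) eqn:E; [discriminate|].
    simpl in H. apply Nat.eqb_eq in H. subst y. apply index_of_None in E.
    contradiction.
Qed.

Lemma lc_sub s :
  Forall closed_e s ->
  (forall e k, lc_e k (sub_e s k e) = lc_e (k + length s) e) /\
  (forall r k, lc_r k (sub_r s k r) = lc_r (k + length s) r) /\
  (forall p k, lc_p k (sub_p s k p) = lc_p (k + length s) p).
Proof.
  intros Hs.
  assert (F : forall A (h : A -> A) (g g' : A -> bool) l,
    Forall (fun x => g (h x) = g' x) l -> forallb g (map h l) = forallb g' l).
  { intros A h g g' l H. induction H; simpl; congruence. }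
  apply syntax_ind; simpl; intros; auto;
    try (apply (f_equal2 andb); auto);
    try (match goal with IH : forall k, _ = _ |- _ => apply (IH (S k)) end);
    try (apply F; eapply Forall_impl; [|eassumption]; simpl; auto; fail).
  destruct (Nat.lt_ge_cases i k) as [Hi|Hi].
  - unfold sub_fv. destruct (Nat.ltb_spec i k); [|lia]. simpl.
    apply eq_iff_eq_true. rewrite !Nat.ltb_lt. lia.
  - destruct (sub_fv_ge s k i Hs Hi) as [[Hin Hlt]|[-> Hge]].
    + rewrite Forall_forall in Hs. apply Hs in Hin.
      rewrite (proj1 lc_mono _ 0 k Hin) by lia. symmetry. apply Nat.ltb_lt. lia.
    + simpl. apply eq_iff_eq_true. rewrite !Nat.ltb_lt. lia.
Qed.

Lemma cnt_lc :
  (forall e k i, lc_e k e = true -> k <= i -> cnt_e i e = 0) /\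
  (forall r k i, lc_r k r = true -> k <= i -> cnt_r i r = 0) /\
  (forall p k i, lc_p k p = true -> k <= i -> cnt_p i p = 0).
Proof.
  assert (Z : forall a b, a = 0 -> b = 0 -> a + b = 0) by lia.
  apply syntax_ind; simpl; intros; auto;
    rewrite ?andb_true_iff, ?Nat.ltb_lt in *;
    try (match goal with |- (if ?i =? ?j then _ else _) = _ =>
           destruct (Nat.eqb_spec i j); lia end);
    repeat match goal with H : _ /\ _ |- _ => destruct H end;
    try apply Z;
    try match goal with
    | IH : forall k d, _ -> _ -> _ _ ?x = 0 |- _ _ ?x = 0 =>
      eapply IH; [eassumption|lia]
    end;
    apply list_sum_0; intros;
    rewrite forallb_forall in *; rewrite Forall_forall in *; eauto.
Qed.

(** Closed entries contribute no variables, and an outer variable remains at or above [c] when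
    lowered, so occurrences of indices below [c] are neither created nor lost. *)
Lemma cnt_sub s :
  Forall closed_e s ->
  (forall e i c, i < c -> cnt_e i (sub_e s c e) = cnt_e i e) /\
  (forall r i c, i < c -> cnt_r i (sub_r s c r) = cnt_r i r) /\
  (forall p i c, i < c -> cnt_p i (sub_p s c p) = cnt_p i p).
Proof.
  intros Hs.
  apply syntax_ind; simpl; intros; rewrite ?map_map; auto;
    try match goal with
    | |- list_sum _ = _ => apply f_equal
    | |- _ + _ = _ => apply (f_equal2 Nat.add)
    end;
    try match goal with
    | |- list_sum _ = _ => apply f_equal
    end;
    try match goal with
    | IH : forall k d, _ -> _ = _ _ ?x |- _ = _ _ ?x => apply IH; lia
    end;
    try (apply map_ext_Forall; eapply Forall_impl; [|eassumption]; simpl; auto; fail).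
  destruct (Nat.lt_ge_cases i c) as [Hi|Hi].
  - unfold sub_fv. destruct (Nat.ltb_spec i c); [|lia]. reflexivity.
  - transitivity 0; [|destruct (Nat.eqb_spec i0 i); [lia|reflexivity]].
    destruct (sub_fv_ge s c i Hs Hi) as [[Hin Hlt]|[-> Hge]].
    + rewrite Forall_forall in Hs. apply Hs in Hin.
      apply (proj1 cnt_lc) with (k := 0); [exact Hin|lia].
    + simpl. destruct (Nat.eqb_spec i0 (i - length s)); [lia|reflexivity].
Qed.

Lemma rig_sub s :
  Forall closed_e s ->
  forall p i c, i < c -> rig_p i (sub_p s c p) = rig_p i p.
Proof.
  intros Hs. destruct (cnt_sub s Hs) as [Hc _].
  apply (pat_nested_ind (fun _ => True) (fun _ => True)
           (fun p => forall i c, i < c -> rig_p i (sub_p s c p) = rig_p i p));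
    simpl; intros; auto.
  - rewrite map_map. apply f_equal, map_ext_Forall.
    eapply Forall_impl; [|eassumption]; simpl; auto.
  - apply H. lia.
Qed.

(** Used contrapositively: a nominal absent from an instantiated pattern is absent from the instance
    of every variable that occurs in the pattern. *)
Lemma occ_sub_intro x s d i :
  i < length s -> occ_e x (nth i s d) = true ->
  (forall e c, 1 <= cnt_e (c + i) e -> occ_e x (sub_e s c e) = true) /\
  (forall r c, 1 <= cnt_r (c + i) r -> occ_r x (sub_r s c r) = true) /\
  (forall p c, 1 <= cnt_p (c + i) p -> occ_p x (sub_p s c p) = true).
Proof.
  intros Hi Hx.
  assert (S2 : forall a b, 1 <= a + b -> 1 <= a \/ 1 <= b) by lia.
  assert (L : forall A (h : A -> A) (occ : A -> bool) (cnt : A -> nat) l,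
    Forall (fun y => 1 <= cnt y -> occ (h y) = true) l ->
    1 <= list_sum (map cnt l) -> existsb occ (map h l) = true).
  { intros A h occ cnt l H Hl. apply list_sum_pos in Hl. destruct Hl as [y [Hy Hl]].
    rewrite Forall_forall in H. apply existsb_exists. exists (h y).
    split; [apply in_map; exact Hy|auto]. }
  apply syntax_ind; simpl; intros; try lia; auto;
    rewrite ?orb_true_iff;
    try match goal with H : 1 <= _ + _ |- _ => apply S2 in H; destruct H; [left|right] end;
    auto;
    try match goal with
    | IH : forall c, _ -> _ _ (_ _ ?x) = true |- _ _ (_ _ ?x) = true =>
      apply (IH (S c)); assumption
    end;
    try (eapply L; [|eassumption]; eapply Forall_impl; [|eassumption]; simpl; auto; fail).
  destruct (Nat.eqb_spec (c + i) i0) as [<-|]; [|lia].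
  unfold sub_fv. destruct (Nat.ltb_spec (c + i) c); [lia|].
  replace (c + i - c) with i by lia. rewrite (nth_indep _ _ d) by assumption.
  exact Hx.
Qed.

(** * Well-formed clauses *)

(* The restrictions on match clauses, with the environment cut down to the
   variables bound by the clause itself, and without any condition on [PNom]:
   evaluating [EArob] may replace an outer nominal variable of a pattern by an
   arbitrary term, so that only this weaker property is preserved. *)
Fixpoint wf_p (l : list kind) (p : pat) : Prop :=
  match p with
  | PVariant _ ps => fold_right (fun q Q => wf_p l q /\ Q) True ps
  | PNom _ => True
  | PVar _ => flex_ok l p []
  | PArob _ _ => flex_ok l p []
  | PBack q => wf_p (KLoc :: l) q
  end.

Fixpoint wf_e (e : expr) : Prop :=
  match e with
  | EBVar _ | ENom _ => True
  | ELam b | EFix b | ENew b | EBack b => wf_e b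
  | EApp m n | EArob m n | ELet m n => wf_e m /\ wf_e n
  | EVariant _ ts => fold_right (fun t Q => wf_e t /\ Q) True ts
  | EMatch t rs => wf_e t /\ fold_right (fun r Q => wf_r [] r /\ Q) True rs
  end
with wf_r (l : list kind) (r : rule) : Prop :=
  match r with
  | RAll b => wf_r (KPat :: l) b
  | RNab b => wf_r (KLoc :: l) b
  | RArrow p u => wf_p l p /\ pat_restr l p /\ wf_e u
  end.

Lemma kind_at_lt l i : kind_at l i <> KOther -> i < length l.
Proof.
  intros H. apply Nat.nle_gt. intros Hi. apply H.
  unfold kind_at. apply nth_overflow, Hi.
Qed.

Lemma flex_ok_args l q args :
  flex_ok l q args -> NoDup args /\ Forall (fun x => kind_at l x = KLoc) args.
Proof.
  revert args. induction q; simpl; intros args H; try contradiction.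
  - destruct e; try contradiction. destruct H as [_ [Hn Ha]].
    split; [exact Hn|]. eapply Forall_impl; [|exact Ha]. simpl. tauto.
  - destruct e; try contradiction. apply IHq in H. destruct H as [Hn Ha].
    inversion Hn; inversion Ha; auto.
Qed.

Definition no_local (k : kind) : Prop := k <> KPat /\ k <> KLoc.

(** Beyond the prefix [l] all kinds are outer ones, including the default [KOther] of [nth], so a
    pattern variable or local nominal must lie in [l]. *)
Lemma kind_at_app l out i :
  Forall no_local out ->
  kind_at (l ++ out) i = KPat \/ kind_at (l ++ out) i = KLoc ->
  kind_at l i = kind_at (l ++ out) i /\ i < length l.
Proof.
  intros Ho H. unfold kind_at in *.
  destruct (Nat.lt_ge_cases i (length l)) as [Hi|Hi].
  - rewrite app_nth1 by assumption. auto.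
  - exfalso. rewrite app_nth2 in H by assumption.
    destruct (Nat.lt_ge_cases (i - length l) (length out)) as [Hj|Hj].
    + rewrite Forall_forall in Ho.
      destruct (Ho _ (nth_In out KOther Hj)). tauto.
    + rewrite nth_overflow in H by assumption. destruct H; discriminate.
Qed.

Lemma flex_ok_app l out q args :
  Forall no_local out -> flex_ok (l ++ out) q args -> flex_ok l q args.
Proof.
  intros Ho. revert args.
  induction q; simpl; intros args H; try contradiction;
    destruct e; try contradiction.
  - destruct H as [Hk [Hn Ha]].
    destruct (kind_at_app l out n Ho (or_introl Hk)) as [-> _].
    split; [exact Hk|]. split; [exact Hn|].
    eapply Forall_impl; [|exact Ha]. simpl. intros x [Hx Hlt].
    destruct (kind_at_app l out x Ho (or_intror Hx)) as [-> _]. auto.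
  - auto.
Qed.

Lemma ok_pat_wf : forall p l out,
  Forall no_local out -> ok_pat (l ++ out) p -> wf_p l p.
Proof.
  apply (pat_nested_ind (fun _ => True) (fun _ => True)
    (fun p => forall l out, Forall no_local out -> ok_pat (l ++ out) p -> wf_p l p));
    auto; intros.
  - simpl in *. rewrite (fold_and_Forall (wf_p l)).
    induction H; constructor.
    + apply (H l out); tauto.
    + apply IHForall. tauto.
  - eapply flex_ok_app; eassumption.
  - simpl in *. apply (H (KLoc :: l) out); assumption.
  - eapply flex_ok_app; eassumption.
Qed.

Lemma pat_restr_app l out p :
  pat_restr (l ++ out) p -> pat_restr l p.
Proof.
  intros H i Hi. assert (Hi' : i < length (l ++ out)) by (rewrite length_app; lia).
  specialize (H i Hi'). unfold kind_at in *. rewrite app_nth1 in H by assumption.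
  exact H.
Qed.

Lemma demote_no_local env : Forall no_local (map demote env).
Proof.
  apply Forall_forall. intros k H. apply in_map_iff in H.
  destruct H as [j [<- _]]. destruct j; split; discriminate.
Qed.

(** An expression is checked in an environment of outer kinds only, whereas the environment of a
    rule splits into the binders [l] of the clause read so far and the outer rest, which [wf_r]
    forgets. Under the arrow, [demote] turns the binders of the clause into outer kinds again. *)
Lemma ok_wf :
  (forall e env, Forall no_local env -> ok_expr env e -> wf_e e) /\
  (forall r l out, Forall no_local out -> ok_rule (l ++ out) r -> wf_r l r) /\
  (forall p : pat, True).
Proof.
  assert (NO : no_local KOther) by (split; discriminate).
  assert (NN : no_local KNomOut) by (split; discriminate).
  apply syntax_ind; simpl; auto; intros;
    repeat match goal with H : _ /\ _ |- _ => destruct H end;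
    repeat match goal with |- _ /\ _ => split end;
    try match goal with
    | IH : forall env, _ -> _ -> wf_e ?x, H : ok_expr _ ?x |- wf_e ?x =>
      eapply IH; [|exact H]; auto
    end.
  - rewrite (fold_and_Forall wf_e).
    induction H as [|t ts Ht _ IH]; constructor.
    + apply (Ht env); tauto.
    + apply IH. tauto.
  - rewrite (fold_and_Forall (wf_r [])).
    match goal with H : Forall _ rs |- _ =>
      induction H as [|r rs Hr _ IH]; constructor end.
    + apply (Hr [] env); tauto.
    + apply IH. tauto.
  - apply (H (KPat :: l) out); assumption.
  - apply (H (KLoc :: l) out); assumption.
  - eapply ok_pat_wf; eassumption.
  - eapply pat_restr_app; eassumption.
  - apply demote_no_local.
Qed.

(** Only variables outside [l] are replaced. Neither such a variable nor what replaces it (a closed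
    term or a lowered outer variable) can be an admissible head or argument, so both sides are then
    false. *)
Lemma flex_ok_sub s l q args c :
  Forall closed_e s -> length l <= c ->
  flex_ok l (sub_p s c q) args <-> flex_ok l q args.
Proof.
  intros Hs Hl. revert args. induction q; simpl; intros args; try tauto.
  - destruct e; simpl; try tauto.
    destruct (Nat.lt_ge_cases n c) as [Hi|Hi].
    + unfold sub_fv. destruct (Nat.ltb_spec n c); [tauto|lia].
    + assert (K : forall j, c <= j -> kind_at l j <> KPat)
        by (intros j Hj E; assert (j < length l); [apply kind_at_lt; congruence|lia]).
      destruct (sub_fv_ge s c n Hs Hi) as [[Hin Hlt]|[-> Hge]].
      * rewrite Forall_forall in Hs. apply Hs in Hin.
        destruct (sub_fv s c n); try discriminate;
          split; try tauto; intros [H _]; apply K in H; tauto.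
      * split; intros [H _]; apply K in H; try lia; tauto.
  - destruct e; simpl; try tauto.
    destruct (Nat.lt_ge_cases n c) as [Hi|Hi].
    + unfold sub_fv. destruct (Nat.ltb_spec n c); [apply IHq|lia].
    + assert (K : forall j q', c <= j -> ~ flex_ok l q' (j :: args)).
      { intros j q' Hj E. apply flex_ok_args in E. destruct E as [_ E].
        inversion E as [|? ? E1 _]; subst.
        assert (j < length l); [apply kind_at_lt; congruence|lia]. }
      destruct (sub_fv_ge s c n Hs Hi) as [[Hin Hlt]|[-> Hge]].
      * rewrite Forall_forall in Hs. apply Hs in Hin.
        destruct (sub_fv s c n); try discriminate;
          split; try tauto; intros H; apply K in H; tauto.
      * split; intros H; apply K in H; try lia; tauto.
Qed.

Lemma pat_restr_sub s l p c :
  Forall closed_e s -> length l <= c ->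
  pat_restr l (sub_p s c p) <-> pat_restr l p.
Proof.
  intros Hs Hl.
  split; intros H i Hi; specialize (H i Hi);
    rewrite (proj2 (proj2 (cnt_sub s Hs))), (rig_sub s Hs) in * by lia; exact H.
Qed.

Lemma Forall_map_iff {A} (P Q : A -> Prop) (f : A -> A) l :
  Forall (fun x => P (f x) <-> Q x) l -> Forall P (map f l) <-> Forall Q l.
Proof.
  induction 1 as [|x l Hx _ IH]; simpl; [split; auto|].
  rewrite !Forall_cons_iff, Hx, IH. reflexivity.
Qed.

(** The direction from the instance back to the term is needed to pass from an opened body to the
    abstraction, for backslash values and for matching under [@]. *)
Lemma wf_sub s :
  Forall closed_e s -> Forall wf_e s ->
  (forall e c, wf_e (sub_e s c e) <-> wf_e e) /\
  (forall r l c, length l <= c -> (wf_r l (sub_r s c r) <-> wf_r l r)) /\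
  (forall p l c, length l <= c -> (wf_p l (sub_p s c p) <-> wf_p l p)).
Proof.
  intros Hs Hw.
  apply syntax_ind; simpl; intros; auto; try tauto;
    rewrite ?(fold_and_Forall wf_e), ?(fold_and_Forall (wf_r [])),
      ?(fold_and_Forall (wf_p l));
    repeat match goal with
    | IH : forall c, wf_e _ <-> wf_e ?x |- _ => rewrite IH; clear IH
    end; try tauto;
    try (rewrite Forall_map_iff; [reflexivity|];
         eapply Forall_impl; [|eassumption]; simpl; auto; fail).
  - split; [auto|intros _]. destruct (Nat.lt_ge_cases i c) as [Hi|Hi].
    + unfold sub_fv. destruct (Nat.ltb_spec i c); [exact I|lia].
    + destruct (sub_fv_ge s c i Hs Hi) as [[Hin Hlt]|[-> Hge]]; [|exact I].
      rewrite Forall_forall in Hw. auto.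
  - rewrite Forall_map_iff; [reflexivity|].
    eapply Forall_impl; [|eassumption]; simpl; intros r Hr. apply Hr. simpl. lia.
  - apply H. simpl. lia.
  - apply H. simpl. lia.
  - rewrite H, pat_restr_sub by assumption. tauto.
  - apply (flex_ok_sub s l (PVar e) [] c); assumption.
  - apply H. simpl. lia.
  - apply (flex_ok_sub s l (PArob q e) [] c); assumption.
Qed.

Lemma wf_open e s : closed_e s -> wf_e s -> (wf_e (open_e e s) <-> wf_e e).
Proof.
  intros Hs Hw. rewrite (proj1 (open_sub s Hs)).
  apply (proj1 (wf_sub [s] (Forall_cons _ Hs (Forall_nil _))
                  (Forall_cons _ Hw (Forall_nil _)))).
Qed.

Lemma closed_open e s : closed_e s -> lc_e 0 (open_e e s) = lc_e 1 e.
Proof.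
  intros Hs. rewrite (proj1 (open_sub s Hs)).
  apply (proj1 (lc_sub [s] (Forall_cons _ Hs (Forall_nil _))) e 0).
Qed.

(** * Determinacy of matching *)

(* Indices grow outwards, so freshness of [a] for the tail says both that local
   nominals are distinct and that none occurs in the instance of a pattern
   variable bound further out. *)
Inductive valid : list kind -> list expr -> Prop :=
| valid_nil : valid [] []
| valid_pat x l s : closed_e x -> valid l s -> valid (KPat :: l) (x :: s)
| valid_loc a l s :
    Forall (fresh_e a) s -> valid l s -> valid (KLoc :: l) (ENom a :: s).

Lemma valid_length l s : valid l s -> length l = length s.
Proof. induction 1; simpl; congruence. Qed.

Lemma valid_closed l s : valid l s -> Forall closed_e s.
Proof. induction 1; constructor; auto. reflexivity. Qed.

Lemma valid_loc_inv l s x :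
  valid l s -> kind_at l x = KLoc ->
  exists a, nth x s (ENom 0) = ENom a /\
    forall j, x < j -> j < length s -> fresh_e a (nth j s (ENom 0)).
Proof.
  intros H. revert x. unfold kind_at.
  induction H as [|y l s Hy _ IH|a l s Ha _ IH]; intros [|x] Hx; simpl in *;
    try discriminate.
  - destruct (IH x Hx) as [a [Ha Hj]]. exists a. split; [exact Ha|].
    intros [|j] H1 H2; [lia|]. apply Hj; lia.
  - exists a. split; [reflexivity|]. intros [|j] H1 H2; [lia|].
    rewrite Forall_forall in Ha. apply Ha, nth_In. lia.
  - destruct (IH x Hx) as [b [Hb Hj]]. exists b. split; [exact Hb|].
    intros [|j] H1 H2; [lia|]. apply Hj; lia.
Qed.

(** Of two local variables, the one with the larger index lies in the tail for which the nominal of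
    the other is fresh. *)
Lemma valid_loc_inj l s x y a b :
  valid l s -> kind_at l x = KLoc -> kind_at l y = KLoc -> x <> y ->
  nth x s (ENom 0) = ENom a -> nth y s (ENom 0) = ENom b -> a <> b.
Proof.
  intros Hv Hx Hy Hxy Ea Eb <-.
  assert (Lx : x < length s)
    by (rewrite <- (valid_length l s Hv); apply kind_at_lt; congruence).
  assert (Ly : y < length s)
    by (rewrite <- (valid_length l s Hv); apply kind_at_lt; congruence).
  destruct (valid_loc_inv l s x Hv Hx) as [a' [Ea' Ha]].
  destruct (valid_loc_inv l s y Hv Hy) as [b' [Eb' Hb]].
  assert (a' = a) by congruence. assert (b' = a) by congruence. subst a' b'.
  assert (N : ~ fresh_e a (ENom a))
    by (unfold fresh_e; simpl; rewrite Nat.eqb_refl; discriminate).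
  apply N. destruct (Nat.lt_total x y) as [H|[H|H]]; [|contradiction|].
  - rewrite <- Eb. auto.
  - rewrite <- Ea. auto.
Qed.

Lemma swap_fresh_p a b p : fresh_p a p -> fresh_p b p -> ren_p (swap a b) p = p.
Proof.
  intros Ha Hb. rewrite <- (proj2 (proj2 tr_id) p 0) at 2.
  apply (proj2 (proj2 (tr_ext True _ _ _ _ (fun _ _ _ => eq_refl)))); auto.
  intros x Hx d. unfold ren_fn, keep_nom, swap, fresh_p in *.
  destruct (Nat.eqb_spec x a), (Nat.eqb_spec x b); congruence.
Qed.

(** The rule for pattern backslash provides some fresh nominal; equivariance under a swap turns it
    into any fresh nominal. *)
Lemma matches_back_inv r q a :
  matches (EBack r) (PBack q) -> fresh_e a r -> fresh_p a q ->
  matches (open_e r (ENom a)) (open_p q (ENom a)).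
Proof.
  intros H Hr Hq. inversion H as [| | |r' q' b Hb Hb' HM|]; subst.
  apply (matches_ren (swap b a) (swap_involutive b a)) in HM.
  rewrite (proj1 (ren_open _ _)), (proj2 (proj2 (ren_open _ _))) in HM.
  rewrite swap_fresh, swap_fresh_p in HM by assumption.
  unfold ren_e, ren_fn in HM. simpl in HM. rewrite swap_l in HM. exact HM.
Qed.

(** Leaving the nominal [a] free to choose allows two matches of the same scrutinee to be opened
    with a common nominal. *)
Lemma matches_PBack_inv t q s :
  Forall closed_e s -> matches t (sub_p s 0 (PBack q)) ->
  exists r, t = EBack r /\
    forall a, fresh_e a r -> fresh_p a (sub_p s 1 q) ->
      matches (open_e r (ENom a)) (sub_p (ENom a :: s) 0 q).
Proof.
  intros Hs H. inversion H as [| | |r q' b Hb Hb' HM|]; subst.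
  exists r. split; [reflexivity|]. intros a Hr Hq.
  apply (matches_back_inv _ _ a) in H; [|assumption|assumption].
  rewrite (proj2 (proj2 (open_sub (ENom a) eq_refl))) in H.
  (* The type ascription turns [[ENom a] ++ s] into a cons by conversion, so that the rewrite finds
     it. *)
  rewrite <- (proj2 (proj2 (sub_sub [ENom a] s Hs)) q : _ = sub_p (ENom a :: s) 0 q).
  exact H.
Qed.

Lemma matches_variant_inv t k ps :
  matches t (PVariant k ps) -> exists ts, t = EVariant k ts /\ Forall2 matches ts ps.
Proof. intros H. inversion H; subst. eauto. Qed.

Lemma Forall2_In_r {A B} (R : A -> B -> Prop) l l' y :
  Forall2 R l l' -> In y l' -> exists x, In x l /\ R x y.
Proof.
  induction 1 as [|x z l l' Hx _ IH]; simpl; [tauto|].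
  intros [<-|H]; [eauto|]. destruct (IH H) as [w [? ?]]; eauto.
Qed.

Lemma Forall2_map_In {A B} (R : A -> B -> Prop) (f g : B -> B) l l' y :
  Forall2 R l (map f l') -> Forall2 R l (map g l') -> In y l' ->
  exists x, In x l /\ R x (f y) /\ R x (g y).
Proof.
  revert l'. induction l as [|x l IH]; intros [|z l'] Hf Hg Hy; simpl in *;
    try contradiction; inversion Hf; inversion Hg; subst.
  destruct Hy as [<-|Hy]; [eauto|].
  destruct (IH l') as [w [? ?]]; auto. eauto.
Qed.

(** Well-formedness puts no condition on the argument of [PNom]. However, substitution keeps every
    head other than a variable, so a term that contains variable [i] and has a nominal as instance
    is that variable. *)
Lemma sub_e_nom s e i a t :
  i < length s -> 1 <= cnt_e i e -> matches t (PNom (sub_e s 0 e)) ->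
  sub_e s 0 e = ENom a -> t = ENom a /\ nth i s (ENom 0) = ENom a.
Proof.
  intros Hi Hc HM He. rewrite He in HM. inversion HM; subst.
  split; [reflexivity|].
  destruct e; simpl in *; try discriminate; try lia.
  destruct (Nat.eqb_spec i n) as [<-|]; [|lia].
  rewrite <- (sub_fv_nth s i (ENom 0) Hi). exact He.
Qed.

Lemma matches_PNom_inv s e i t :
  i < length s -> 1 <= cnt_e i e -> matches t (PNom (sub_e s 0 e)) ->
  t = nth i s (ENom 0) /\ exists a, t = ENom a.
Proof.
  intros Hi Hc HM. assert (H := HM). inversion H as [|a E1 E2| | |]; subst.
  symmetry in E2.
  destruct (sub_e_nom s e i a _ Hi Hc HM E2) as [_ ->]. eauto.
Qed.

(** A rigid occurrence of a local variable leads to a [PNom], where the corresponding part of the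
    scrutinee is the nominal itself. The path to it is the same for both matches. *)
Lemma rigid_det : forall p l s s' t i,
  wf_p l p -> valid l s -> valid l s' ->
  matches t (sub_p s 0 p) -> matches t (sub_p s' 0 p) ->
  kind_at l i = KLoc -> 1 <= rig_p i p ->
  nth i s (ENom 0) = nth i s' (ENom 0).
Proof.
  apply (pat_nested_ind (fun _ => True) (fun _ => True) (fun p => forall l s s' t i,
    wf_p l p -> valid l s -> valid l s' ->
    matches t (sub_p s 0 p) -> matches t (sub_p s' 0 p) ->
    kind_at l i = KLoc -> 1 <= rig_p i p ->
    nth i s (ENom 0) = nth i s' (ENom 0))); auto.
  - intros k ps IH l s s' t i Hw Hv Hv' HM HM' Hk Hr. simpl in *.
    rewrite (fold_and_Forall (wf_p l)), Forall_forall in Hw.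
    rewrite Forall_forall in IH.
    apply list_sum_pos in Hr. destruct Hr as [q [Hq Hr]].
    apply matches_variant_inv in HM, HM'.
    destruct HM as [ts [-> HM]], HM' as [ts' [E HM']].
    injection E as <-.
    destruct (Forall2_map_In _ _ _ _ _ q HM HM' Hq) as [t [_ [Ht Ht']]].
    eapply (IH q Hq); eauto.
  - intros e _ l s s' t i _ Hv Hv' HM HM' Hk Hr. simpl in *.
    assert (Hi : i < length l) by (apply kind_at_lt; congruence).
    apply matches_PNom_inv with (i := i) in HM, HM';
      try (rewrite <- (valid_length l) by assumption); try assumption.
    destruct HM, HM'. congruence.
  (* The argument of [PVar] has kind [KPat], so it is not a local nominal, although [rig_p] counts
     it. *)
  - intros e _ l s s' t i Hw _ _ _ _ Hk Hr. simpl in *.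
    destruct e; try contradiction. simpl in Hr.
    destruct (Nat.eqb_spec i n) as [<-|]; [|lia]. destruct Hw. congruence.
  - intros q IH l s s' t i Hw Hv Hv' HM HM' Hk Hr.
    assert (Hs := valid_closed l s Hv). assert (Hs' := valid_closed l s' Hv').
    apply matches_PBack_inv in HM, HM'; try assumption.
    destruct HM as [r [-> HM]], HM' as [r' [E HM']]. injection E as <-.
    (* One nominal fresh for both substitutions keeps both extended lists valid and the scrutinee
       common. *)
    destruct (fresh_exists (r :: s ++ s') [sub_p s 1 q; sub_p s' 1 q])
      as [a [Ha Ha']].
    inversion_clear Ha as [|? ? Har Has]. apply Forall_app in Has.
    inversion_clear Ha' as [|? ? Haq Ha'']. inversion_clear Ha'' as [|? ? Haq' _].
    apply (IH (KLoc :: l) (ENom a :: s) (ENom a :: s') (open_e r (ENom a)) (S i));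
      try constructor; try tauto; auto.
  - intros q e _ _ l s s' t i _ _ _ _ _ _ Hr. simpl in Hr. lia.
Qed.

Lemma matches_PVar_inv s t r :
  r < length s -> matches t (sub_p s 0 (PVar (EBVar r))) -> t = nth r s (ENom 0).
Proof.
  intros Hr H. simpl in H. rewrite (sub_fv_nth _ _ (ENom 0)) in H by assumption.
  inversion H. reflexivity.
Qed.

Lemma matches_PArob_inv l s t q x :
  valid l s -> kind_at l x = KLoc -> matches t (sub_p s 0 (PArob q (EBVar x))) ->
  exists r a, nth x s (ENom 0) = ENom a /\
    matches (EBack r) (sub_p s 0 q) /\ t = open_e r (ENom a).
Proof.
  intros Hv Hx H.
  assert (L : x < length s)
    by (rewrite <- (valid_length l s Hv); apply kind_at_lt; congruence).
  destruct (valid_loc_inv l s x Hv Hx) as [a [Ea _]].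
  simpl in H. rewrite (sub_fv_nth _ _ (ENom 0)), Ea in H by assumption.
  inversion H; subst. eauto.
Qed.

Lemma flex_ok_head l q x args :
  flex_ok l (PArob q (EBVar x)) args ->
  kind_at l x = KLoc /\ ~ In x args /\ flex_ok l q (x :: args).
Proof.
  simpl. intros H. destruct (flex_ok_args _ _ _ H) as [Hn Hk].
  inversion Hn; inversion Hk; subst. auto.
Qed.

(** [args] are the arguments applied further out. Their nominals do not occur in the instance of the
    head, being bound inside its scope, and the arguments that [q] itself inserts into [t] are
    different nominals. *)
Lemma flex_fresh l s q : valid l s -> forall t args y a,
  flex_ok l q args -> matches t (sub_p s 0 q) ->
  In y args -> nth y s (ENom 0) = ENom a -> fresh_e a t.
Proof.
  intros Hv. induction q; intros t args y a Hf HM Hy Ea;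
    try contradiction; destruct e; try contradiction.
  - destruct Hf as [Hr [_ Ha]]. rewrite Forall_forall in Ha.
    destruct (Ha y Hy) as [Hk Hlt].
    assert (L : n < length s)
      by (rewrite <- (valid_length l s Hv); apply kind_at_lt; congruence).
    apply matches_PVar_inv in HM; [|assumption]. subst t.
    destruct (valid_loc_inv l s y Hv Hk) as [b [Eb Hb]].
    replace a with b by congruence. auto.
  - assert (Hy' := proj2 (flex_ok_args _ _ _ Hf)). rewrite Forall_forall in Hy'.
    apply flex_ok_head in Hf. destruct Hf as [Hx [Hn Hf]].
    apply matches_PArob_inv with (l := l) in HM; try assumption.
    destruct HM as [r [b [Eb [HM ->]]]].
    apply fresh_open_e.
    + apply (valid_loc_inj l s y n); auto. congruence.
    + apply (IHq (EBack r) (n :: args) y a); simpl; auto.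
Qed.

(** Uniqueness of higher-order pattern solutions: at each [@] both abstractions open to [t] at the
    same nominal, which is fresh for both by [flex_fresh], so they coincide. At the head the
    scrutinee is the instance itself. *)
Lemma flex_det l s s' q :
  valid l s -> valid l s' ->
  (forall x, kind_at l x = KLoc -> nth x s (ENom 0) = nth x s' (ENom 0)) ->
  forall t args i,
  flex_ok l q args -> matches t (sub_p s 0 q) -> matches t (sub_p s' 0 q) ->
  kind_at l i = KPat -> 1 <= cnt_p i q ->
  nth i s (ENom 0) = nth i s' (ENom 0).
Proof.
  intros Hv Hv' Hl. induction q; intros t args i Hf HM HM' Hk Hc;
    try contradiction; destruct e; try contradiction; simpl in Hc.
  - destruct (Nat.eqb_spec i n) as [<-|]; [|lia].
    assert (L : i < length l) by (apply kind_at_lt; congruence).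
    apply matches_PVar_inv in HM, HM';
      try (rewrite <- (valid_length l) by assumption); try assumption.
    congruence.
  - apply flex_ok_head in Hf. destruct Hf as [Hx [Hn Hf]].
    destruct (Nat.eqb_spec i n) as [<-|]; [congruence|].
    apply matches_PArob_inv with (l := l) in HM, HM'; try assumption.
    destruct HM as [r [b [Eb [HM ->]]]], HM' as [r' [b' [Eb' [HM' E]]]].
    rewrite <- Hl in Eb' by assumption. replace b' with b in * by congruence.
    apply open_nom_inj in E.
    + subst r'. apply (IHq (EBack r) (n :: args)); auto. lia.
    + apply (flex_fresh l s q Hv (EBack r) (n :: args) n b); simpl; auto.
    + rewrite Hl in Eb by assumption.
      apply (flex_fresh l s' q Hv' (EBack r') (n :: args) n b); simpl; auto.
Qed.

Lemma pat_var_det : forall p l s s' t i,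
  wf_p l p -> valid l s -> valid l s' ->
  (forall x, kind_at l x = KLoc -> nth x s (ENom 0) = nth x s' (ENom 0)) ->
  matches t (sub_p s 0 p) -> matches t (sub_p s' 0 p) ->
  kind_at l i = KPat -> 1 <= cnt_p i p ->
  nth i s (ENom 0) = nth i s' (ENom 0).
Proof.
  apply (pat_nested_ind (fun _ => True) (fun _ => True) (fun p => forall l s s' t i,
    wf_p l p -> valid l s -> valid l s' ->
    (forall x, kind_at l x = KLoc -> nth x s (ENom 0) = nth x s' (ENom 0)) ->
    matches t (sub_p s 0 p) -> matches t (sub_p s' 0 p) ->
    kind_at l i = KPat -> 1 <= cnt_p i p ->
    nth i s (ENom 0) = nth i s' (ENom 0))); auto.
  - intros k ps IH l s s' t i Hw Hv Hv' Hl HM HM' Hk Hr. simpl in *.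
    rewrite (fold_and_Forall (wf_p l)), Forall_forall in Hw.
    rewrite Forall_forall in IH.
    apply list_sum_pos in Hr. destruct Hr as [q [Hq Hr]].
    apply matches_variant_inv in HM, HM'.
    destruct HM as [ts [-> HM]], HM' as [ts' [E HM']].
    injection E as <-.
    destruct (Forall2_map_In _ _ _ _ _ q HM HM' Hq) as [t [_ [Ht Ht']]].
    eapply (IH q Hq); eauto.
  - intros e _ l s s' t i _ Hv Hv' _ HM HM' Hk Hr. simpl in *.
    assert (Hi : i < length l) by (apply kind_at_lt; congruence).
    apply matches_PNom_inv with (i := i) in HM, HM';
      try (rewrite <- (valid_length l) by assumption); try assumption.
    destruct HM, HM'. congruence.
  - intros e _ l s s' t i Hw Hv Hv' Hl HM HM' Hk Hr.
    apply (flex_det l s s' (PVar e) Hv Hv' Hl t []); assumption.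
  - intros q IH l s s' t i Hw Hv Hv' Hl HM HM' Hk Hr.
    assert (Hs := valid_closed l s Hv). assert (Hs' := valid_closed l s' Hv').
    apply matches_PBack_inv in HM, HM'; try assumption.
    destruct HM as [r [-> HM]], HM' as [r' [E HM']]. injection E as <-.
    destruct (fresh_exists (r :: s ++ s') [sub_p s 1 q; sub_p s' 1 q])
      as [a [Ha Ha']].
    inversion_clear Ha as [|? ? Har Has]. apply Forall_app in Has.
    inversion_clear Ha' as [|? ? Haq Ha'']. inversion_clear Ha'' as [|? ? Haq' _].
    apply (IH (KLoc :: l) (ENom a :: s) (ENom a :: s') (open_e r (ENom a)) (S i));
      try constructor; try tauto; auto.
    (* Index 0 is the new local nominal, shared by both lists by choice. *)
    intros [|x] Hx; [reflexivity|]. apply Hl. exact Hx.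
  - intros q e _ _ l s s' t i Hw Hv Hv' Hl HM HM' Hk Hr.
    apply (flex_det l s s' (PArob q e) Hv Hv' Hl t []); assumption.
Qed.

(** The instance of the head is the scrutinee with some nominals abstracted, and [wf_e] does not
    distinguish a nominal from a variable. *)
Lemma flex_wf l s q : valid l s -> forall t args i,
  flex_ok l q args -> wf_e t -> matches t (sub_p s 0 q) ->
  kind_at l i = KPat -> 1 <= cnt_p i q -> wf_e (nth i s (ENom 0)).
Proof.
  intros Hv. induction q; intros t args i Hf Hw HM Hk Hc;
    try contradiction; destruct e; try contradiction; simpl in Hc.
  - destruct (Nat.eqb_spec i n) as [<-|]; [|lia].
    apply matches_PVar_inv in HM; [congruence|].
    rewrite <- (valid_length l s Hv). apply kind_at_lt. congruence.
  - apply flex_ok_head in Hf. destruct Hf as [Hx [Hn Hf]].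
    destruct (Nat.eqb_spec i n) as [<-|]; [congruence|].
    apply matches_PArob_inv with (l := l) in HM; try assumption.
    destruct HM as [r [b [_ [HM ->]]]].
    rewrite wf_open in Hw by (reflexivity || exact I).
    apply (IHq (EBack r) (n :: args)); auto. lia.
Qed.

Lemma matches_wf : forall p l s t i,
  wf_p l p -> valid l s -> wf_e t -> matches t (sub_p s 0 p) ->
  kind_at l i = KPat -> 1 <= cnt_p i p -> wf_e (nth i s (ENom 0)).
Proof.
  apply (pat_nested_ind (fun _ => True) (fun _ => True) (fun p => forall l s t i,
    wf_p l p -> valid l s -> wf_e t -> matches t (sub_p s 0 p) ->
    kind_at l i = KPat -> 1 <= cnt_p i p -> wf_e (nth i s (ENom 0)))); auto.
  - intros k ps IH l s t i Hw Hv Ht HM Hk Hr. simpl in *.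
    rewrite (fold_and_Forall (wf_p l)), Forall_forall in Hw.
    rewrite Forall_forall in IH.
    apply list_sum_pos in Hr. destruct Hr as [q [Hq Hr]].
    apply matches_variant_inv in HM. destruct HM as [ts [-> HM]].
    simpl in Ht. rewrite (fold_and_Forall wf_e), Forall_forall in Ht.
    destruct (Forall2_In_r _ _ _ _ HM (in_map _ _ _ Hq)) as [t [Hin Hm]].
    eapply (IH q Hq); eauto.
  - intros e _ l s t i _ Hv Ht HM Hk Hr. simpl in *.
    apply matches_PNom_inv with (i := i) in HM; try assumption.
    + destruct HM as [<- _]. exact Ht.
    + rewrite <- (valid_length l s Hv). apply kind_at_lt. congruence.
  - intros e _ l s t i Hw Hv Ht HM Hk Hr.
    apply (flex_wf l s (PVar e) Hv t []); assumption.
  - intros q IH l s t i Hw Hv Ht HM Hk Hr.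
    assert (Hs := valid_closed l s Hv).
    apply matches_PBack_inv in HM; try assumption. destruct HM as [r [-> HM]].
    destruct (fresh_exists (r :: s) [sub_p s 1 q]) as [a [Ha Ha']].
    inversion_clear Ha as [|? ? Har Has]. inversion_clear Ha' as [|? ? Haq _].
    apply (IH (KLoc :: l) (ENom a :: s) (open_e r (ENom a)) (S i));
      try constructor; auto.
    rewrite wf_open by (reflexivity || exact I). exact Ht.
  - intros q e _ _ l s t i Hw Hv Ht HM Hk Hr.
    apply (flex_wf l s (PArob q e) Hv t []); assumption.
Qed.

(** * Clauses *)

Lemma iter_RNab_sub s m : forall c r p u,
  Nat.iter m RNab (RArrow p u) = sub_r s c r ->
  exists p0 u0, r = Nat.iter m RNab (RArrow p0 u0) /\
    p = sub_p s (m + c) p0 /\ u = sub_e s (m + c) u0.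
Proof.
  induction m as [|m IH]; simpl; intros c r p u H.
  - destruct r; try discriminate. injection H as -> ->. eauto.
  - destruct r; try discriminate. injection H as H. apply IH in H.
    destruct H as [p0 [u0 [-> [-> ->]]]]. rewrite Nat.add_succ_r. eauto.
Qed.

(** The flattening is proved for a rule [r] under a pending substitution [s], since each [all] adds
    its instance in front of [s]. *)
Lemma clause_inst t r' u : clause t r' u -> forall r s,
  r' = sub_r s 0 r -> Forall closed_e s ->
  exists k m p u0 xs cs,
    r = Nat.iter k RAll (Nat.iter m RNab (RArrow p u0)) /\
    length xs = k /\ length cs = m /\ NoDup cs /\ Forall closed_e xs /\
    (forall a, In a cs -> fresh_p a (sub_p (xs ++ s) m p)) /\
    matches t (sub_p (map ENom cs ++ xs ++ s) 0 p) /\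
    u = sub_e (map ENom cs ++ xs ++ s) 0 u0.
Proof.
  induction 1 as [t r' u x Hx _ IH|t m p u P U HM [cs [Hl [Hn Hc]]]];
    intros r s E Hs.
  - destruct r as [b| |]; try discriminate. injection E as ->.
    destruct (IH b (x :: s)) as [k [m [p [u0 [xs [cs H]]]]]].
    + rewrite (proj1 (proj2 (open_sub x Hx))).
      apply (proj1 (proj2 (sub_sub [x] s Hs)) b).
    + auto.
    + destruct H as [-> [Hk [Hm [Hn [Hxs [Hf [HM Hu]]]]]]].
      (* The variable opened first is the outermost of the clause, so its instance comes last. *)
      exists (S k), m, p, u0, (xs ++ [x]), cs.
      rewrite <- app_assoc. simpl. rewrite length_app, Nat.add_comm. simpl.
      rewrite Hk. repeat split; auto.
      apply Forall_app. auto.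
  - apply iter_RNab_sub in E. destruct E as [p0 [u0 [-> [-> ->]]]].
    rewrite Nat.add_0_r in Hc.
    exists 0, m, p0, u0, [], (rev cs). simpl.
    rewrite length_rev. repeat split; auto.
    + apply NoDup_rev, Hn.
    (* The pattern under the [nab] prefix is the result of a closing over [cs], hence free of these
       nominals. *)
    + intros a Ha. apply in_rev in Ha.
      assert (F := close_fresh cs a (RArrow P U) Ha). rewrite <- Hc in F.
      simpl in F. apply orb_false_iff in F. apply F.
    + assert (F := sub_close cs (RArrow P U)). rewrite <- Hc in F. simpl in F.
      injection F as <- _.
      assert (L : length (map ENom (rev cs)) = m)
        by (rewrite length_map, length_rev; exact Hl).
      rewrite <- (proj2 (proj2 (sub_sub _ s Hs))), L. exact HM.
    + assert (F := sub_close cs (RArrow P U)). rewrite <- Hc in F. simpl in F.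
      injection F as _ <-.
      assert (L : length (map ENom (rev cs)) = m)
        by (rewrite length_map, length_rev; exact Hl).
      rewrite <- (proj1 (sub_sub _ s Hs)), L. reflexivity.
Qed.

Lemma wf_iter_RAll k : forall l r,
  wf_r l (Nat.iter k RAll r) -> wf_r (repeat KPat k ++ l) r.
Proof.
  induction k as [|k IH]; simpl; intros l r H; [exact H|].
  apply IH in H. change (KPat :: l) with ([KPat] ++ l) in H.
  rewrite app_assoc, <- repeat_cons in H. exact H.
Qed.

Lemma wf_iter_RNab m : forall l r,
  wf_r l (Nat.iter m RNab r) -> wf_r (repeat KLoc m ++ l) r.
Proof.
  induction m as [|m IH]; simpl; intros l r H; [exact H|].
  apply IH in H. change (KLoc :: l) with ([KLoc] ++ l) in H.
  rewrite app_assoc, <- repeat_cons in H. exact H.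
Qed.

Lemma lc_iter (b : rule -> rule) k :
  (forall d r, lc_r d (b r) = lc_r (S d) r) ->
  forall d r, lc_r d (Nat.iter k b r) = lc_r (k + d) r.
Proof.
  intros Hb. induction k as [|k IH]; simpl; intros d r; [reflexivity|].
  rewrite Hb, IH, Nat.add_succ_r. reflexivity.
Qed.

(** The arrow ends both prefixes, so two derivations for the same rule share the numbers of [all]
    and [nab] as well as pattern and body. *)
Lemma iter_clause_inj k : forall k' m m' p p' u u',
  Nat.iter k RAll (Nat.iter m RNab (RArrow p u)) =
  Nat.iter k' RAll (Nat.iter m' RNab (RArrow p' u')) ->
  k = k' /\ m = m' /\ p = p' /\ u = u'.
Proof.
  assert (N : forall m m' p p' u u',
    Nat.iter m RNab (RArrow p u) = Nat.iter m' RNab (RArrow p' u') ->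
    m = m' /\ p = p' /\ u = u').
  { induction m as [|m IH]; intros [|m'] p p' u u' H; simpl in H; try discriminate.
    - injection H as -> ->. auto.
    - injection H as H. apply IH in H. intuition. }
  induction k as [|k IH]; intros [|k'] m m' p p' u u' H; simpl in H.
  - apply N in H. auto.
  - destruct m; discriminate.
  - destruct m'; discriminate.
  - injection H as H. apply IH in H. intuition.
Qed.

(** A derivable clause has its [nab] binders inside its [all] binders, so the local nominals have
    the smallest indices. *)
Definition clause_kinds (k m : nat) : list kind := repeat KLoc m ++ repeat KPat k.

Lemma clause_kinds_cases k m i :
  i < length (clause_kinds k m) ->
  kind_at (clause_kinds k m) i = KLoc \/ kind_at (clause_kinds k m) i = KPat.
Proof.
  intros H. unfold kind_at.
  assert (Hin := nth_In (clause_kinds k m) KOther H).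
  apply in_app_or in Hin. destruct Hin as [Hin|Hin]; apply repeat_spec in Hin; auto.
Qed.

Lemma valid_clause cs xs :
  NoDup cs -> Forall closed_e xs ->
  (forall a, In a cs -> Forall (fresh_e a) xs) ->
  valid (clause_kinds (length xs) (length cs)) (map ENom cs ++ xs).
Proof.
  intros Hn Hx Hf. unfold clause_kinds. induction Hn as [|c cs Hc Hn IH]; simpl in *.
  - clear Hf. induction Hx; simpl; constructor; auto.
  - constructor; auto. apply Forall_app. split; [|auto].
    apply Forall_forall. intros e He. apply in_map_iff in He.
    destruct He as [b [<- Hb]]. unfold fresh_e. simpl.
    apply Nat.eqb_neq. intros ->. contradiction.
Qed.

Lemma clause_inv t r u :
  lc_r 0 r = true -> wf_r [] r -> clause t r u ->
  exists k m p u0 s,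
    let l := clause_kinds k m in
    r = Nat.iter k RAll (Nat.iter m RNab (RArrow p u0)) /\
    valid l s /\ wf_p l p /\ pat_restr l p /\
    lc_e (length l) u0 = true /\ wf_e u0 /\
    matches t (sub_p s 0 p) /\ u = sub_e s 0 u0.
Proof.
  intros Hlc Hw HC.
  destruct (clause_inst _ _ _ HC r [] (eq_sym (proj1 (proj2 sub_nil) r 0)) (Forall_nil _))
    as [k [m [p [u0 [xs [cs [Hr [Hk [Hm [Hn [Hx [Hf [HM Hu]]]]]]]]]]]]].
  rewrite app_nil_r in *. subst r.
  apply wf_iter_RAll, wf_iter_RNab in Hw. rewrite app_nil_r in Hw.
  destruct Hw as [Hwp [Hre Hwu]].
  rewrite !lc_iter in Hlc by reflexivity. simpl in Hlc.
  apply andb_true_iff in Hlc. destruct Hlc as [_ Hlc].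
  exists k, m, p, u0, (map ENom cs ++ xs). simpl.
  assert (Hlen : length (clause_kinds k m) = m + k)
    by (unfold clause_kinds; rewrite length_app, !repeat_length; reflexivity).
  repeat split; auto; try apply Hre; auto.
  (* The nominals [cs] are absent from the pattern with its instances filled in, and by restriction
     (1) every pattern variable occurs there, so they are absent from the instances. *)
  - subst k m. apply valid_clause; auto. intros a Ha.
    apply Forall_forall. intros x Hin. apply (In_nth _ _ (ENom 0)) in Hin.
    destruct Hin as [j [Hj <-]]. apply not_true_iff_false. intros Ho.
    specialize (Hf a Ha). unfold fresh_p in Hf.
    rewrite (proj2 (proj2 (occ_sub_intro a xs (ENom 0) j Hj Ho))) in Hf;
      [discriminate|].
    (* The indices of the local nominals precede those of the pattern variables. *)
    destruct (Hre (length cs + j)) as [HP _].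
    + fold (clause_kinds (length xs) (length cs)). lia.
    + rewrite HP; [lia|]. unfold kind_at.
      rewrite app_nth2; rewrite repeat_length; [|lia].
      rewrite nth_repeat_lt by lia. reflexivity.
  - rewrite Hlen. rewrite Nat.add_0_r in Hlc. exact Hlc.
Qed.

(** Restriction (3) supplies the rigid occurrences that identify the local nominals, and restriction
    (1) the occurrences that then identify the pattern variables. *)
Lemma clause_det t r u u' :
  lc_r 0 r = true -> wf_r [] r -> clause t r u -> clause t r u' -> u = u'.
Proof.
  intros Hlc Hw H H'. apply clause_inv in H, H'; auto.
  destruct H as [k [m [p [u0 [s [E [Hv [Hp [Hr [_ [_ [HM ->]]]]]]]]]]]].
  destruct H' as [k' [m' [p' [u0' [s' [E' [Hv' [_ [_ [_ [_ [HM' ->]]]]]]]]]]]].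
  rewrite E in E'. apply iter_clause_inj in E'.
  destruct E' as [<- [<- [<- <-]]].
  assert (Hl : forall x, kind_at (clause_kinds k m) x = KLoc ->
            nth x s (ENom 0) = nth x s' (ENom 0)).
  { intros x Hx. eapply rigid_det; eauto. apply Hr; [|exact Hx].
    apply kind_at_lt. congruence. }
  replace s' with s; [reflexivity|].
  apply nth_ext with (d := ENom 0) (d' := ENom 0).
  - rewrite <- (valid_length _ _ Hv). apply valid_length, Hv'.
  - intros i Hi. rewrite <- (valid_length _ _ Hv) in Hi.
    destruct (clause_kinds_cases k m i Hi) as [Hk|Hk]; [auto|].
    eapply pat_var_det; eauto. rewrite (proj1 (Hr i Hi) Hk). lia.
Qed.

(** Closedness of [u] makes the hit and miss rules exclude each other; well-formedness of the
    instances is inherited from the scrutinee through the match. *)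
Lemma clause_preserves t r u :
  wf_e t -> lc_r 0 r = true -> wf_r [] r -> clause t r u -> closed_e u /\ wf_e u.
Proof.
  intros Ht Hlc Hw H. apply clause_inv in H; auto.
  destruct H as [k [m [p [u0 [s [_ [Hv [Hp [Hr [Hu [Hwu [HM ->]]]]]]]]]]]].
  assert (Hc := valid_closed _ _ Hv).
  split.
  - unfold closed_e. rewrite (proj1 (lc_sub s Hc)), <- (valid_length _ _ Hv). exact Hu.
  - assert (Hs : Forall wf_e s).
    { apply Forall_forall. intros x Hx. apply (In_nth _ _ (ENom 0)) in Hx.
      destruct Hx as [i [Hi <-]]. rewrite <- (valid_length _ _ Hv) in Hi.
      destruct (clause_kinds_cases k m i Hi) as [Hk|Hk].
      - destruct (valid_loc_inv _ _ i Hv Hk) as [a [-> _]]. exact I.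
      - apply (matches_wf p (clause_kinds k m) s t i); auto.
        rewrite (proj1 (Hr i Hi) Hk). lia. }
    apply (proj1 (wf_sub s Hc Hs)), Hwu.
Qed.

(** * Evaluation *)

Definition good (e : expr) : Prop := closed_e e /\ wf_e e.

Lemma good_open e s : good s -> (good (open_e e s) <-> lc_e 1 e = true /\ wf_e e).
Proof.
  intros [Hc Hw]. unfold good, closed_e.
  rewrite closed_open, wf_open by assumption. reflexivity.
Qed.

Lemma good_nom a : good (ENom a).
Proof. split; [reflexivity|exact I]. Qed.

Lemma good_variant k ts : good (EVariant k ts) <-> Forall good ts.
Proof.
  unfold good, closed_e. simpl.
  rewrite (fold_and_Forall wf_e), forallb_forall, !Forall_forall.
  firstorder.
Qed.

Lemma good_match_cons t r rs :
  good (EMatch t (r :: rs)) ->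
  wf_e t /\ lc_r 0 r = true /\ wf_r [] r /\ good (EMatch t rs).
Proof.
  unfold good, closed_e. simpl. rewrite !andb_true_iff. tauto.
Qed.

Lemma good_pair m n :
  lc_e 0 m && lc_e 0 n = true /\ wf_e m /\ wf_e n -> good m /\ good n.
Proof. unfold good, closed_e. rewrite andb_true_iff. tauto. Qed.

Lemma eval_good e v : eval e v -> good e -> good v.
Proof.
  induction 1 as [r|c ts vs _ IH|e v a _ _ _ IH|m n r u v _ IH1 _ IH2 _ IH3
    |m r u v _ IH1 _ IH2|r v _ IH|m x r v _ IH1 _ IH2|e v a _ _ _ IH
    |t rl rls u v HC _ IH|t rl rls v HN _ IH] using eval_nested_ind; intros G.
  - exact G.
  - rewrite good_variant in *. induction IH; auto.
    inversion_clear G. constructor; auto.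
  - apply IH, good_open; [apply good_nom|exact G].
  - apply good_pair in G. destruct G as [Gm Gn].
    apply IH3, good_open; auto. apply IH1, Gm.
  - destruct G as [Gc [Gm Gr]]. apply andb_true_iff in Gc. destruct Gc as [Cm Cr].
    apply IH2, good_open; [|split; assumption]. apply IH1. split; assumption.
  - apply IH, good_open; exact G.
  - apply good_pair in G. destruct G as [Gm Gx].
    apply IH2, good_open; auto. apply IH1, Gm.
  (* Here the equivalence is also read backwards, from the opened value to its body. *)
  - apply (good_open v (ENom a)); [apply good_nom|].
    apply IH, good_open; [apply good_nom|exact G].
  - apply good_match_cons in G. destruct G as [Gt [Gl [Gr _]]].
    apply IH. eapply clause_preserves; eauto.
  - apply good_match_cons in G. apply IH. tauto.
Qed.

(* If a nominal of [v] were absent from [e], renaming it would give a second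
   value of [e]. *)
Lemma unique_value_fresh e v a :
  eval e v -> (forall u, eval e u -> v = u) -> fresh_e a e -> fresh_e a v.
Proof.
  intros He Hd Ha. destruct (fresh_exists [e; v] []) as [b [Hb _]].
  inversion_clear Hb as [|? ? Hbe Hb']. inversion_clear Hb' as [|? ? Hbv _].
  apply (eval_ren (swap a b) (swap_involutive a b)) in He.
  rewrite (swap_fresh a b e Ha Hbe) in He. apply Hd in He. rewrite He.
  rewrite <- (swap_r a b) at 1. unfold fresh_e.
  rewrite (proj1 (occ_ren _ (involutive_inj _ (swap_involutive a b)) b)).
  exact Hbv.
Qed.

Lemma ren_swap_open a b e :
  fresh_e a e -> fresh_e b e ->
  ren_e (swap a b) (open_e e (ENom a)) = open_e e (ENom b) /\
  ren_e (swap a b) (open_e e (ENom b)) = open_e e (ENom a).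
Proof.
  intros Ha Hb. rewrite !(proj1 (ren_open _ _)), swap_fresh by assumption.
  unfold ren_e. simpl. unfold ren_fn. rewrite swap_l, swap_r. auto.
Qed.

Lemma eval_det e v : eval e v -> good e -> forall u, eval e u -> v = u.
Proof.
  induction 1 as [r|c ts vs _ IH|e v a He Hv Ev IH
    |m n r u v E1 IH1 E2 IH2 _ IH3
    |m r u v E1 IH1 _ IH2|r v _ IH|m x r v E1 IH1 _ IH2|e v a He Hv Ev IH
    |t rl rls u v HC _ IH|t rl rls v HN _ IH] using eval_nested_ind; intros G w Ew.
  - inversion Ew. reflexivity.
  - rewrite good_variant in G. inversion Ew as [|c' ts' ws F| | | | | | | |]; subst.
    f_equal. clear Ew. revert ws F.
    induction IH as [|t v ts vs Hv _ IH]; intros ws F; inversion F; subst; auto.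
    inversion_clear G. f_equal; auto.
  - inversion Ew as [| |e' w' b Hbe Hbw Ew'| | | | | | |]; subst.
    assert (Go : good (open_e e (ENom a))) by (apply good_open; [apply good_nom|exact G]).
    destruct (Nat.eq_dec a b) as [<-|Hab]; [apply IH; assumption|].
    assert (Hbv : fresh_e b v).
    (* The induction hypothesis is the uniqueness that [unique_value_fresh] asks for. *)
    { eapply unique_value_fresh; eauto. apply fresh_open_e; auto. }
    apply (eval_ren (swap a b) (swap_involutive a b)) in Ew'.
    rewrite (proj2 (ren_swap_open a b e He Hbe)) in Ew'.
    apply IH in Ew'; [|assumption].
    (* Swapping [w] yields [v], and both nominals are fresh for [v], so swapping back changes
       nothing. *)
    rewrite <- (proj1 (ren_involutive _ (swap_involutive a b)) w), <- Ew'.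
    symmetry. apply swap_fresh; assumption.
  - inversion Ew as [| | |m' n' r' u' w' F1 F2 F3| | | | | |]; subst.
    apply good_pair in G. destruct G as [Gm Gn].
    apply IH1 in F1; [|exact Gm]. injection F1 as <-.
    apply IH2 in F2; [|exact Gn]. subst u'.
    apply IH3; [|exact F3]. apply good_open.
    + eapply eval_good; eauto.
    + apply (eval_good _ _ E1 Gm).
  - inversion Ew as [| | | |m' r' u' w' F1 F2| | | | |]; subst.
    destruct G as [Gc [Gm Gr]]. apply andb_true_iff in Gc. destruct Gc as [Cm Cr].
    apply IH1 in F1; [|split; assumption]. subst u'.
    apply IH2; [|exact F2]. apply good_open; [|split; assumption].
    apply (eval_good _ _ E1). split; assumption.
  - inversion Ew; subst. apply IH; [|assumption]. apply good_open; exact G.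
  - inversion Ew as [| | | | | |m' x' r' w' F1 F2| | |]; subst.
    apply good_pair in G. destruct G as [Gm Gx].
    apply IH1 in F1; [|exact Gm]. injection F1 as <-.
    apply IH2; [|exact F2]. apply good_open; [exact Gx|].
    apply (eval_good _ _ E1 Gm).
  - inversion Ew as [| | | | | | |e' w' b Hbe Hbw Ew'| |]; subst.
    assert (Go : good (open_e e (ENom a))) by (apply good_open; [apply good_nom|exact G]).
    assert (Hbv : fresh_e b v).
    { destruct (Nat.eq_dec a b) as [<-|Hab]; [exact Hv|].
      apply fresh_open_e_inv with (s := ENom a).
      eapply unique_value_fresh; eauto. apply fresh_open_e; auto. }
    (* Unlike for [new], the value may mention the nominal through its opening, so the two bodies
       are compared after opening both at [b]. *)
    f_equal. apply (open_nom_inj b); [exact Hbv|exact Hbw|].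
    apply (eval_ren (swap a b) (swap_involutive a b)) in Ew'.
    rewrite (proj2 (ren_swap_open a b e He Hbe)) in Ew'.
    apply IH in Ew'; [|assumption].
    rewrite <- (proj1 (ren_swap_open a b v Hv Hbv)), Ew'.
    apply (proj1 (ren_involutive _ (swap_involutive a b))).
  - apply good_match_cons in G. destruct G as [Gt [Gl [Gr _]]].
    destruct (clause_preserves _ _ _ Gt Gl Gr HC) as [Hcu Hwu].
    inversion Ew as [| | | | | | | |t' rl' rls' u' w' HC' F|t' rl' rls' w' HN F]; subst.
    + apply IH; [split; assumption|].
      rewrite (clause_det _ _ _ _ Gl Gr HC HC'). exact F.
    (* A hit against a miss: the result of the hit is closed, hence a witness for the existential
       that the miss rule denies. *)
    + exfalso. eauto.
  - apply good_match_cons in G. destruct G as [Gt [Gl [Gr Gs]]].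
    inversion Ew as [| | | | | | | |t' rl' rls' u' w' HC' F|t' rl' rls' w' HN' F]; subst.
    + exfalso. apply HN. exists u'. split; [|exact HC'].
      eapply clause_preserves; eauto.
    + auto.
Qed.

Theorem mainTheorem3 (E V U : expr) :
  closed_e E -> ok_expr nil E -> eval E V -> eval E U -> V = U.
Proof.
  intros Hc Hok HV HU. apply (eval_det E V HV); [|exact HU].
  split; [exact Hc|]. apply (proj1 ok_wf E [] (Forall_nil _) Hok).
Qed.
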